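(* Let $\Bbbk$ be an algebraically closed field of characteristic zero and let $t\in\mathbb{Z}_{>0}$, viewed as an element of $\Bbbk$. Then Deligne's category $\underline{\mathrm{Rep}}\,S_t$ has a unique tensor ideal which is neither zero nor the whole category, namely the ideal of negligible morphisms.
   Context: $\underline{\mathrm{Rep}}\,S_t$ is the pseudo-abelian envelope (idempotent completion of the additive envelope) of the partition category $\mathbf{C}_0$ over $\Bbbk$: objects of $\mathbf C_0$ are $\mathbb{N}$, $\mathbf{C}_0(i,j)$ has as $\Bbbk$-basis the set partitions of the disjoint union of $i$ lower dots and $j$ upper dots; composition is given by stacking partition diagrams, joining blocks, and replacing each connected component lying only in the middle row by the scalar $t$; $i\otimes j=i+j$, and the tensor product of diagrams is juxtaposition. The unit is $0$. It is a rigid symmetric monoidal category. A tensor ideal $\mathcal{J}$ in a monoidal category $\mathbf C$ consists of subgroups $\mathcal{J}(X,Y)\subset\mathbf{C}(X,Y)$ for all objects $X,Y$, closed under pre- and post-composition with arbitrary morphisms and such that $f\in\mathcal{J}(X,Y)$ implies $1_Z\otimes f\in\mathcal{J}(Z\otimes X,Z\otimes Y)$ for all $Z$. In a rigid monoidal category with braiding $\gamma$, the trace of $f\in\mathrm{End}(X)$ is $\mathrm{tr}(f)=\mathrm{ev}_X\circ\gamma_{X^\vee,X}\circ(1_{X^\vee}\otimes f)\circ\mathrm{co}_X\in\mathrm{End}(\mathbf 1)$, with $\mathrm{ev}_X:X\otimes X^\vee\to\mathbf{1}$ and $\mathrm{co}_X:\mathbf{1}\to X^\vee\otimes X$ the duality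 morphisms. A morphism $f:X\to Y$ is negligible if $\mathrm{tr}(g\circ f)=0$ for all $g:Y\to X$. *)

(* Defs.v *)
From HB Require Import structures.
From mathcomp Require Import all_boot all_order all_algebra.

Set Implicit Arguments.
Unset Strict Implicit.
Unset Printing Implicit Defensive.

Import GRing.Theory.

(* Rep S_t is built in steps: set partitions, diagrams and their stacking,    *)
(* the partition category (p- prefix), its additive envelope (a- prefix) and  *)
(* the idempotent completion of the latter (obj, khom and k- prefix). The     *)
(* laws proved on the way make the operations well defined; identities of     *)
(* diagrams are reduced to counting the two-colourings of the dots that are   *)
(* constant on blocks (compat).                                               *)

Definition setpart (T : finType) := {P : {set {set T}} | partition P [set: T]}.

(* u and v lie in the same block of P.                                        *)
Definition same (T : finType) (P : setpart T) : rel T :=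
  fun u v => v \in pblock (val P) u.

(* The partition of T into the nonempty fibres of f.                          *)
Definition fibers (T : finType) (rT : eqType) (f : T -> rT) : setpart T :=
  exist _ (preim_partition f [set: T]) (preim_partitionP f [set: T]).

Lemma same_pblockE (T : finType) (P : setpart T) u v :
  same P u v = (pblock (val P) u == pblock (val P) v).
Proof.
case: P => P /= Ppart; rewrite /same /=.
have [/eqP cov tI _] := and3P Ppart.
by rewrite eq_pblock // cov inE.
Qed.

Lemma same_refl (T : finType) (P : setpart T) u : same P u u.
Proof. by rewrite same_pblockE. Qed.

Lemma same_fibers (T : finType) (rT : eqType) (f : T -> rT) u v :
  same (fibers f) u v = (f u == f v).
Proof.
rewrite /same /= pblock_equivalence_partition ?inE //.
by split=> // /eqP->.
Qed.

Lemma setpart_ext (T : finType) (P Q : setpart T) : same P =2 same Q -> P = Q.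
Proof.
move=> eqPQ; apply: val_inj.
rewrite -(equivalence_partition_pblock (valP P)).
rewrite -(equivalence_partition_pblock (valP Q)).
by apply: eq_imset => x; apply/setP=> y; rewrite !inE /=; apply: eqPQ.
Qed.

Definition compat (T : finType) (C : eqType) (P : setpart T) (c : T -> C) :=
  [forall u, [forall v, same P u v ==> (c u == c v)]].

Lemma compatP (T : finType) (C : eqType) (P : setpart T) (c : T -> C) :
  reflect (forall u v, same P u v -> c u = c v) (compat P c).
Proof.
apply: (iffP forallP) => [H u v Puv|H u].
  by have /forallP/(_ v)/implyP/(_ Puv)/eqP := H u.
by apply/forallP=> v; apply/implyP=> /H->.
Qed.

Lemma eq_compat (T : finType) (C : eqType) (P : setpart T) (c d : T -> C) :
  c =1 d -> compat P c = compat P d.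
Proof.
by move=> e; apply/compatP/compatP=> H u v /H; rewrite !e.
Qed.

Lemma setpart_compat_inj (T : finType) (P Q : setpart T) m n :
  (forall c : T -> bool, compat P c * 2 ^ m = compat Q c * 2 ^ n)%N ->
  P = Q /\ m = n.
Proof.
move=> H.
have emn : m = n.
  have := H (fun=> true).
  have -> : compat P (fun=> true) by apply/compatP.
  have -> : compat Q (fun=> true) by apply/compatP.
  by rewrite !mul1n => /eqP; rewrite eqn_exp2l // => /eqP.
split=> //; subst n.
have {}H (c : T -> bool) : compat P c = compat Q c.
  have /eqP := H c; rewrite eqn_pmul2r ?expn_gt0 // => /eqP.
  by do 2!case: compat.
apply: setpart_ext => u v; apply/idP/idP => [Puv|Quv].
  have : compat Q (fun w => same Q u w).
    apply/compatP=> a b; rewrite !same_pblockE => /eqP->; exact: erefl.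
  by rewrite -H => /compatP/(_ _ _ Puv); rewrite same_refl => <-.
have : compat P (fun w => same P u w).
  apply/compatP=> a b; rewrite !same_pblockE => /eqP->; exact: erefl.
by rewrite H => /compatP/(_ _ _ Quv); rewrite same_refl => <-.
Qed.

Section Stack.
Variables (I J L : finType).

(* The rows of the stacked diagram are I (bottom), J (middle) and L (top). *)
Definition stack_low (u : I + J) : I + J + L := inl u.
Definition stack_up (u : J + L) : I + J + L :=
  match u with inl j => inl (inr j) | inr l => inr l end.
Definition stack_out (u : I + L) : I + J + L :=
  match u with inl i => inl (inl i) | inr l => inr l end.

Variables (Q : setpart (J + L)%type) (P : setpart (I + J)%type).

Definition stack_link : rel (I + J + L)%type := fun u v =>
  [exists a, exists b, [&& same P a b, u == stack_low a & v == stack_low b]]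
  || [exists a, exists b, [&& same Q a b, u == stack_up a & v == stack_up b]].

Definition stack_component (u : I + J + L) : {set I + J + L} :=
  [set v | connect stack_link u v].

(* Q on top of P: the blocks are the traces on the outer rows of the connected *)
(* components of the stack; the components lost are the inner ones.           *)
Definition diag_comp : setpart (I + L)%type :=
  fibers (fun o => stack_component (stack_out o)).

Definition inner_components : {set {set I + J + L}} :=
  [set A in [set stack_component u | u : (I + J + L)%type]
     | [forall o, stack_out o \notin A]].

Definition nloops : nat := #|inner_components|.

Lemma stack_linkP u v :
  reflect ((exists a b, [/\ same P a b, u = stack_low a & v = stack_low b])
           \/ (exists a b, [/\ same Q a b, u = stack_up a & v = stack_up b]))
          (stack_link u v).
Proof.
apply: (iffP orP) => -[].
- by case/existsP=> a /existsP[b /and3P[? /eqP-> /eqP->]]; left; exists a, b.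
- by case/existsP=> a /existsP[b /and3P[? /eqP-> /eqP->]]; right; exists a, b.
- case=> a [b [H -> ->]]; left; apply/existsP; exists a; apply/existsP.
  by exists b; rewrite H !eqxx.
- case=> a [b [H -> ->]]; right; apply/existsP; exists a; apply/existsP.
  by exists b; rewrite H !eqxx.
Qed.

Lemma stack_link_sym : connect_sym stack_link.
Proof.
apply: sym_connect_sym; apply: symmetric_from_pre => u v.
have sS (T : finType) (R : setpart T) a b : same R a b -> same R b a.
  by rewrite !same_pblockE eq_sym.
case/stack_linkP=> -[a [b [H -> ->]]]; apply/stack_linkP; [left|right];
  by exists b, a; split=> //; apply: sS.
Qed.

Lemma stack_component_eq u v :
  (stack_component u == stack_component v) = connect stack_link u v.
Proof.
apply/eqP/idP=> [/setP/(_ v)|cuv].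
  by rewrite !inE connect0.
apply/setP=> w; rewrite !inE.
by rewrite (same_connect stack_link_sym cuv).
Qed.

Lemma same_diag_comp a b :
  same diag_comp a b = connect stack_link (stack_out a) (stack_out b).
Proof. by rewrite same_fibers stack_component_eq. Qed.

End Stack.

Definition sumf (I J : finType) (C : Type) (x : I -> C) (y : J -> C) : I + J -> C :=
  fun u => match u with inl i => x i | inr j => y j end.

Section Count.
Variables (I J L C : finType) (c0 : C).
Variables (Q : setpart (J + L)%type) (P : setpart (I + J)%type).
Variables (x : I -> C) (z : L -> C).

Let T := (I + J + L)%type.
Let comp := stack_component Q P.
Let N := inner_components Q P.
Let W (y : J -> C) : T -> C := sumf (sumf x y) z.

Let SW (y : J -> C) : compat P (sumf x y) && compat Q (sumf y z) ->
  forall u v, connect (stack_link Q P) u v -> W y u = W y v.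
Proof.
move=> /andP[/compatP cP /compatP cQ] u v /connectP[p pp ->].
elim: p u pp => //= w p IH u /andP[/stack_linkP uw /IH <-].
case: uw => -[a [b [Hab -> ->]]].
  exact: cP.
by have := cQ _ _ Hab; case: a b {Hab} => [a|a] [b|b].
Qed.

Let WS (y : J -> C) : (forall u v, stack_link Q P u v -> W y u = W y v) ->
   compat P (sumf x y) && compat Q (sumf y z).
Proof.
move=> H; apply/andP; split; apply/compatP => a b ab.
  by apply: (H (inl a) (inl b)); apply/stack_linkP; left; exists a, b.
have := H (stack_up I a) (stack_up I b).
have -> : stack_link Q P (stack_up I a) (stack_up I b).
  by apply/stack_linkP; right; exists a, b.
by move/(_ isT); case: a b {ab} => [a|a] [b|b].
Qed.

Let Wout y o : W y (stack_out J o) = sumf x z o.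
Proof. by case: o. Qed.

Let inner (u : T) : {j | u = inl (inr j)} + {o | u = stack_out J o}.
Proof.
case: u => [[i|j]|l].
- by right; exists (inl i).
- by left; exists j.
- by right; exists (inr l).
Defined.

Let h (g : {ffun {set T} -> C}) : {ffun J -> C} :=
  [ffun j => let A := comp (inl (inr j)) in
     if [pick o | stack_out J o \in A] is Some o then sumf x z o else g A].

Let compN u : (comp u \in N) = [forall o, stack_out J o \notin comp u].
Proof.
by rewrite inE; case: imsetP => // -[]; exists u.
Qed.

Let g_of (y : {ffun J -> C}) : {ffun {set T} -> C} :=
  [ffun A => if A \in N then
     (if [pick j | inl (inr j) \in A] is Some j then y j else c0) else c0].

Lemma count_compat :
  (\sum_(y : {ffun J -> C}) compat P (sumf x y) * compat Q (sumf y z)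
   = compat (diag_comp Q P) (sumf x z) * #|C| ^ nloops Q P)%N.
Proof.
set S := [set y : {ffun J -> C} | compat P (sumf x y) && compat Q (sumf y z)].
have -> : (\sum_(y : {ffun J -> C}) compat P (sumf x y) * compat Q (sumf y z)
   = #|S|)%N.
  rewrite -sum1_card [RHS]big_mkcond; apply: eq_bigr => y _; rewrite inE.
  by do 2!case: compat.
case: (boolP (compat (diag_comp Q P) _)) => [/compatP cQP|ncQP]; last first.
  rewrite mul0n; apply/eqP; rewrite cards_eq0; apply/eqP/setP=> y.
  rewrite !inE; apply: contraNF ncQP => yS; apply/compatP => a b.
  by rewrite same_diag_comp => /(SW yS); rewrite !Wout.
have hW g u : W (h g) u =
    if [pick o | stack_out J o \in comp u] is Some o then sumf x z o
    else g (comp u).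
  case: (inner u) => [[j ->]|[o ->]]; first by rewrite /= /h ffunE.
  rewrite Wout; case: pickP => [o'|/(_ o)].
    by rewrite inE -same_diag_comp => /cQP.
  by rewrite inE connect0.
have -> : S = h @: [set g in pffun_on c0 (mem N) predT].
  apply/setP=> y; apply/idP/imsetP => [yS|[g _ ->]]; last first.
    rewrite inE; apply: WS => u v uv.
    suff euv : comp u = comp v by rewrite !hW euv.
    by apply/eqP; rewrite stack_component_eq connect1.
  rewrite inE in yS; exists (g_of y).
    rewrite inE; apply/pffun_onP; split=> //.
    apply/subsetP=> A; rewrite !inE ffunE; apply: contraNT => AN.
    by rewrite inE (negbTE AN).
  apply/ffunP=> j; rewrite [RHS]ffunE.
  rewrite /=; case: pickP => [o|noo].
    by rewrite inE => /(SW yS); rewrite Wout.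
  rewrite ffunE compN; case: forallP => [_|[]]; last by move=> o; rewrite noo.
  case: pickP => [j'|/(_ j)]; last by rewrite inE connect0.
  by rewrite inE => /(SW yS).
rewrite card_in_imset.
  by rewrite cardsE card_pffun_on mul1n.
move=> g1 g2; rewrite !inE => /pffun_onP[/subsetP s1 _] /pffun_onP[/subsetP s2 _] e.
apply/ffunP=> A; case: (boolP (A \in N)) => AN; last first.
  have := contra (s1 A) AN; have := contra (s2 A) AN.
  by rewrite !inE !negbK => /eqP-> /eqP->.
have : A \in [set stack_component Q P u | u : T].
  by move: AN; rewrite inE => /andP[].
case/imsetP=> u _ eA; move: AN; rewrite eA compN => /forallP Ao.
have := congr1 (fun y : {ffun J -> C} => W y u) e; rewrite /= !hW.
by case: pickP => // o; rewrite (negbTE (Ao o)).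
Qed.

End Count.

Lemma sumfE (I J : finType) (C : Type) (c : I + J -> C) :
  sumf (fun i => c (inl i)) (fun j => c (inr j)) =1 c.
Proof. by case. Qed.

Lemma diag_ext (I J : finType) (P Q : setpart (I + J)%type) m n :
  (forall (x : I -> bool) (y : J -> bool),
     compat P (sumf x y) * 2 ^ m = compat Q (sumf x y) * 2 ^ n)%N ->
  P = Q /\ m = n.
Proof.
move=> H; apply: setpart_compat_inj => c.
by rewrite -!(eq_compat _ (sumfE c)).
Qed.

Lemma count2 (I J L : finType)
    (Q : setpart (J + L)%type) (P : setpart (I + J)%type)
    (x : I -> bool) (z : L -> bool) :
  (compat (diag_comp Q P) (sumf x z) * 2 ^ nloops Q P
   = \sum_(y : {ffun J -> bool}) compat P (sumf x y) * compat Q (sumf y z))%N.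
Proof. by rewrite (count_compat true) card_bool. Qed.

Lemma diag_compA (I J L M : finType) (R : setpart (L + M)%type)
    (Q : setpart (J + L)%type) (P : setpart (I + J)%type) :
  diag_comp R (diag_comp Q P) = diag_comp (diag_comp R Q) P /\
  (nloops Q P + nloops R (diag_comp Q P)
   = nloops R Q + nloops (diag_comp R Q) P)%N.
Proof.
apply: diag_ext => x w.
rewrite [in LHS]addnC.
rewrite [in RHS]addnC.
rewrite !expnD.
rewrite !mulnA.
rewrite (count2 R).
rewrite (count2 (diag_comp R Q)).
rewrite !big_distrl /=.
transitivity (\sum_(z : {ffun L -> bool}) \sum_(y : {ffun J -> bool})
   compat P (sumf x y) * compat Q (sumf y z) * compat R (sumf z w))%N.
  apply: eq_bigr => z _.
  by rewrite mulnAC count2 big_distrl.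
rewrite exchange_big /=; apply: eq_bigr => y _.
rewrite -mulnA count2 big_distrr /=; apply: eq_bigr => z _.
by rewrite mulnA.
Qed.

Definition diag_id (I : finType) : setpart (I + I)%type :=
  fibers (fun u : I + I => match u with inl x | inr x => x end).

Lemma compat_id (I : finType) (C : eqType) (x y : I -> C) :
  compat (diag_id I) (sumf x y) = [forall i, x i == y i].
Proof.
apply/compatP/forallP => [H i|H u v].
  by apply/eqP/(H (inl i) (inr i)); rewrite same_fibers.
by rewrite same_fibers; case: u v => a [] b /eqP->; rewrite //= ?(eqP (H b)).
Qed.

Lemma diag_id_comp (I J : finType) (P : setpart (I + J)%type) :
  diag_comp (diag_id J) P = P /\ nloops (diag_id J) P = 0%N.
Proof.
apply: diag_ext => x z; rewrite (count2 (diag_id J)) muln1.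
rewrite (bigD1 [ffun j => z j]) //= big1 ?addn0 => [|y ny]; last first.
  rewrite compat_id; case: forallP => [H|_]; last by rewrite muln0.
  by case/eqP: ny; apply/ffunP => j; rewrite ffunE (eqP (H j)).
rewrite compat_id; have -> : [forall j, [ffun j => z j] j == z j].
  by apply/forallP => j; rewrite ffunE.
by rewrite muln1; congr nat_of_bool; apply: eq_compat; case=> //= j; rewrite ffunE.
Qed.

Definition sum_swap (I J : Type) (u : I + J) : J + I :=
  match u with inl i => inr i | inr j => inl j end.

Lemma sum_swapK (I J : Type) : cancel (@sum_swap I J) (@sum_swap J I).
Proof. by case. Qed.

Definition diag_flip (I J : finType) (P : setpart (I + J)%type) :
    setpart (J + I)%type :=
  fibers (fun u => pblock (val P) (sum_swap u)).

Lemma same_flip (I J : finType) (P : setpart (I + J)%type) u v :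
  same (diag_flip P) u v = same P (sum_swap u) (sum_swap v).
Proof. by rewrite same_fibers -same_pblockE. Qed.

Lemma diag_flipK (I J : finType) : cancel (@diag_flip I J) (@diag_flip J I).
Proof.
by move=> P; apply: setpart_ext => u v; rewrite !same_flip !sum_swapK.
Qed.

Lemma compat_flip (I J : finType) (C : eqType) (P : setpart (I + J)%type)
    (x : I -> C) (y : J -> C) :
  compat (diag_flip P) (sumf y x) = compat P (sumf x y).
Proof.
have E u : sumf y x u = sumf x y (sum_swap u) by case: u.
apply/compatP/compatP => H u v uv.
  have := H (sum_swap u) (sum_swap v).
  by rewrite !E same_flip !sum_swapK => /(_ uv).
by rewrite !E; apply: H; rewrite -same_flip.
Qed.

Lemma diag_flip_comp (I J L : finType) (Q : setpart (J + L)%type)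
    (P : setpart (I + J)%type) :
  diag_comp (diag_flip P) (diag_flip Q) = diag_flip (diag_comp Q P) /\
  nloops (diag_flip P) (diag_flip Q) = nloops Q P.
Proof.
apply: diag_ext => z x; rewrite (count2 (diag_flip P)) compat_flip (count2 Q).
by apply: eq_bigr => y _; rewrite !compat_flip mulnC.
Qed.

Definition diag (i j : nat) := setpart ('I_i + 'I_j)%type.

Section Tensor.
Variables (i j k l : nat).

Definition tens_split (u : 'I_(i + k) + 'I_(j + l)) :
    ('I_i + 'I_j) + ('I_k + 'I_l) :=
  match u with
  | inl x => match split x with inl a => inl (inl a) | inr b => inr (inl b) end
  | inr y => match split y with inl a => inl (inr a) | inr b => inr (inr b) end
  end.

Definition diag_tens (P : diag i j) (Q : diag k l) : diag (i + k) (j + l) :=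
  fibers (fun u => match tens_split u with
                   | inl v => inl (pblock (val P) v)
                   | inr v => inr (pblock (val Q) v)
                   end).

Lemma same_tens P Q u v : same (diag_tens P Q) u v =
  match tens_split u, tens_split v with
  | inl a, inl b => same P a b
  | inr a, inr b => same Q a b
  | _, _ => false
  end.
Proof.
rewrite same_fibers.
by case: (tens_split u) (tens_split v) => [a|a] [b|b] //; rewrite same_pblockE.
Qed.

Lemma compat_tens (C : eqType) P Q (x : 'I_(i + k) -> C) (y : 'I_(j + l) -> C) :
  compat (diag_tens P Q) (sumf x y) =
  compat P (sumf (fun a => x (lshift k a)) (fun a => y (lshift l a))) &&
  compat Q (sumf (fun a => x (rshift i a)) (fun a => y (rshift j a))).
Proof.
have lK m n (a : 'I_m) : split (lshift n a) = inl a by exact: (unsplitK (inl a)).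
have rK m n (a : 'I_n) : split (rshift m a) = inr a by exact: (unsplitK (inr a)).
apply/compatP/andP => [H|[/compatP H1 /compatP H2] u v].
  split; apply/compatP=> u v uv.
    pose e (u : 'I_i + 'I_j) : 'I_(i + k) + 'I_(j + l) :=
      match u with inl a => inl (lshift k a) | inr a => inr (lshift l a) end.
    have := H (e u) (e v); rewrite same_tens.
    by case: u v uv => [a|a] [b|b] uv /=; rewrite !lK => /(_ uv).
  pose e (u : 'I_k + 'I_l) : 'I_(i + k) + 'I_(j + l) :=
    match u with inl a => inl (rshift i a) | inr a => inr (rshift j a) end.
  have := H (e u) (e v); rewrite same_tens.
  by case: u v uv => [a|a] [b|b] uv /=; rewrite !rK => /(_ uv).
rewrite same_tens.
have spl m n (a : 'I_(m + n)) : a = unsplit (split a) by rewrite splitK.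
have E u' : sumf x y u' = match tens_split u' with
   | inl a => sumf (fun a => x (lshift k a)) (fun a => y (lshift l a)) a
   | inr a => sumf (fun a => x (rshift i a)) (fun a => y (rshift j a)) a end.
  by case: u' => a /=; rewrite [in LHS](spl _ _ a); case: (split a).
rewrite !E; case: (tens_split u) (tens_split v) => [a|a] [b|b] //.
  exact: H1.
exact: H2.
Qed.

End Tensor.

Lemma sum_bool_split (m n : nat) (F : {ffun 'I_m -> bool} -> nat)
    (G : {ffun 'I_n -> bool} -> nat) :
  (\sum_(y : {ffun 'I_(m + n) -> bool})
     F [ffun a => y (lshift n a)] * G [ffun a => y (rshift m a)]
   = (\sum_y F y) * \sum_y G y)%N.
Proof.
rewrite big_distrl /=.
under [RHS]eq_bigr do rewrite big_distrr /=.
rewrite pair_big /=.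
pose f (y : {ffun 'I_(m + n) -> bool}) :=
  ([ffun a => y (lshift n a)] : {ffun 'I_m -> bool},
   [ffun a => y (rshift m a)] : {ffun 'I_n -> bool}).
pose g (p : {ffun 'I_m -> bool} * {ffun 'I_n -> bool}) :
  {ffun 'I_(m + n) -> bool} :=
  [ffun a => match split a with inl b => p.1 b | inr b => p.2 b end].
rewrite [RHS](reindex f) //=; exists g => [y _|[y1 y2] _].
  apply/ffunP=> a; rewrite ffunE -[in RHS](splitK a).
  by case: (split a) => b /=; rewrite ffunE.
congr pair; apply/ffunP => a; rewrite !ffunE.
  by rewrite (unsplitK (inl a)).
by rewrite (unsplitK (inr a)).
Qed.

Lemma diag_tens_comp (i j k i' j' k' : nat)
    (Q : diag j k) (P : diag i j) (Q' : diag j' k') (P' : diag i' j') :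
  diag_comp (diag_tens Q Q') (diag_tens P P')
  = diag_tens (diag_comp Q P) (diag_comp Q' P') /\
  nloops (diag_tens Q Q') (diag_tens P P') = (nloops Q P + nloops Q' P')%N.
Proof.
apply: diag_ext => x z; rewrite (count2 (diag_tens Q Q')) compat_tens -mulnb.
rewrite expnD mulnACA (count2 Q) (count2 Q').
rewrite -sum_bool_split; apply: eq_bigr => y _; rewrite !compat_tens -!mulnb.
by rewrite mulnACA; congr (_ * _ * (_ * _))%N; congr nat_of_bool;
  apply: eq_compat; case=> a //=; rewrite ffunE.
Qed.

(* Position of a dot of a row obtained by juxtaposing two rows of dots.       *)
Definition dot_label (i j : nat) (x : 'I_(i + j)) : nat + nat :=
  match split x with inl a => inl (val a) | inr b => inr (val b) end.

(* For i = j these are the evaluation, coevaluation and (for i = i', j = j')  *)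
(* symmetry of the partition category; only these cases are used, the general *)
(* indices just avoid transporting along equalities of naturals.              *)
Definition diag_ev (i j : nat) : diag (i + j) 0 :=
  fibers (fun u => match u with
                   | inl x => match dot_label x with inl n | inr n => n end
                   | inr _ => 0%N
                   end).

Definition diag_co (i j : nat) : diag 0 (i + j) := diag_flip (diag_ev i j).

Definition diag_braid (i j j' i' : nat) : diag (i + j) (j' + i') :=
  fibers (fun u => match u with
                   | inl x => dot_label x
                   | inr y => sum_swap (dot_label y)
                   end).

Local Open Scope ring_scope.

Section Bilinear.
Variables (K : comNzRingType) (A B C : finType).

Definition basis (D : finType) (a : D) : {ffun D -> K^o} :=
  [ffun b => (b == a)%:R].

Variables (w : A -> B -> K) (op : A -> B -> C).

(* The bilinear map sending a pair (a, b) of basis vectors to w a b *: op a b. *)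
Definition bilin (g : {ffun A -> K^o}) (f : {ffun B -> K^o}) : {ffun C -> K^o} :=
  \sum_a \sum_b (g a * f b * w a b) *: basis (op a b).

Lemma bilinPl c g1 g2 f : bilin (c *: g1 + g2) f = c *: bilin g1 f + bilin g2 f.
Proof.
rewrite /bilin scaler_sumr -big_split; apply: eq_bigr => a _ /=.
rewrite scaler_sumr -big_split; apply: eq_bigr => b _ /=.
by rewrite !ffunE scalerA -scalerDl !mulrDl !mulrA.
Qed.

Lemma bilinPr c g f1 f2 : bilin g (c *: f1 + f2) = c *: bilin g f1 + bilin g f2.
Proof.
rewrite /bilin scaler_sumr -big_split; apply: eq_bigr => a _ /=.
rewrite scaler_sumr -big_split; apply: eq_bigr => b _ /=.
by rewrite !ffunE scalerA -scalerDl mulrDr mulrDl [g a * (c * _)]mulrCA !mulrA.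
Qed.

Lemma bilinDl g1 g2 f : bilin (g1 + g2) f = bilin g1 f + bilin g2 f.
Proof. by have := bilinPl 1 g1 g2 f; rewrite !scale1r. Qed.

Lemma bilinDr g f1 f2 : bilin g (f1 + f2) = bilin g f1 + bilin g f2.
Proof. by have := bilinPr 1 g f1 f2; rewrite !scale1r. Qed.

Lemma bilin0l f : bilin 0 f = 0.
Proof. by apply: (addrI (bilin 0 f)); rewrite -bilinDl !addr0. Qed.

Lemma bilin0r g : bilin g 0 = 0.
Proof. by apply: (addrI (bilin g 0)); rewrite -bilinDr !addr0. Qed.

Lemma bilinZl c g f : bilin (c *: g) f = c *: bilin g f.
Proof. by have := bilinPl c g 0 f; rewrite !addr0 bilin0l addr0. Qed.

Lemma bilinZr c g f : bilin g (c *: f) = c *: bilin g f.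
Proof. by have := bilinPr c g f 0; rewrite !addr0 bilin0r addr0. Qed.

Lemma bilin_suml (I : finType) (F : I -> {ffun A -> K^o}) f :
  bilin (\sum_i F i) f = \sum_i bilin (F i) f.
Proof. exact: (big_morph (bilin^~ f) (fun x y => bilinDl x y f) (bilin0l f)). Qed.

Lemma bilin_sumr (I : finType) g (F : I -> {ffun B -> K^o}) :
  bilin g (\sum_i F i) = \sum_i bilin g (F i).
Proof. exact: (big_morph (bilin g) (bilinDr g) (bilin0r g)). Qed.

Lemma bilin_basis a b : bilin (basis a) (basis b) = w a b *: basis (op a b).
Proof.
rewrite /bilin (bigD1 a) //= [X in _ + X]big1 ?addr0 => [|a' na]; last first.
  by rewrite big1 // => b' _; rewrite ffunE (negbTE na) !mul0r scale0r.
rewrite (bigD1 b) //= [X in _ + X]big1 ?addr0 => [|b' nb]; last first.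
  by rewrite !ffunE (negbTE nb) mulr0 mul0r scale0r.
by rewrite !ffunE !eqxx !mul1r.
Qed.

End Bilinear.

Lemma basis_ind (K : comNzRingType) (A : finType)
    (Pr : {ffun A -> K^o} -> Prop) :
  Pr 0 -> (forall c a f, Pr f -> Pr (c *: basis K a + f)) -> forall f, Pr f.
Proof.
move=> P0 PD f.
have -> : f = \sum_a f a *: basis K a.
  apply/ffunP => a; rewrite sum_ffunE (bigD1 a) //= big1 ?addr0 => [|b nb].
    by rewrite !ffunE eqxx [_ *: _]mulr1.
  by rewrite !ffunE eq_sym (negbTE nb) scaler0.
elim/big_rec: _ => // a g _; exact: PD.
Qed.

Section Partition.
Variables (K : comNzRingType) (t : K).

Definition phom (i j : nat) := {ffun diag i j -> K^o}.

Definition pid (i : nat) : phom i i := basis K (diag_id 'I_i).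

Definition pcomp i j k (g : phom j k) (f : phom i j) : phom i k :=
  bilin (fun Q P => t ^+ nloops Q P) (fun Q P => diag_comp Q P) g f.

Definition ptens i j k l (f : phom i j) (g : phom k l) : phom (i + k) (j + l) :=
  bilin (fun _ _ => 1) (@diag_tens i j k l) f g.

Definition pflip i j (f : phom i j) : phom j i :=
  [ffun D => f (diag_flip D)].

Definition pev i j : phom (i + j) 0 := basis K (diag_ev i j).
Definition pco i j : phom 0 (i + j) := basis K (diag_co i j).
Definition pbraid i j j' i' : phom (i + j) (j' + i') :=
  basis K (diag_braid i j j' i').

Lemma pcompA i j k l (h : phom k l) (g : phom j k) (f : phom i j) :
  pcomp h (pcomp g f) = pcomp (pcomp h g) f.
Proof.
rewrite /pcomp; elim/basis_ind: f => [|a P f IHf]; first by rewrite !bilin0r.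
rewrite !bilinPr IHf; congr (_ *: _ + _) => {f IHf}.
elim/basis_ind: g => [|b Q g IHg]; first by rewrite !(bilin0l, bilin0r).
rewrite !(bilinPl, bilinPr) IHg; congr (_ *: _ + _) => {g IHg}.
elim/basis_ind: h => [|c R h IHh]; first by rewrite !bilin0l.
rewrite !bilinPl IHh; congr (_ *: _ + _) => {h IHh}.
rewrite !bilin_basis bilinZl bilinZr !bilin_basis !scalerA -!exprD.
by have [-> ->] := diag_compA R Q P.
Qed.

Lemma pid_comp i j (f : phom i j) : pcomp (pid j) f = f.
Proof.
rewrite /pcomp; elim/basis_ind: f => [|a P f IHf]; first by rewrite bilin0r.
rewrite bilinPr IHf bilin_basis; have [-> ->] := diag_id_comp P.
by rewrite scale1r.
Qed.

Lemma ptens_comp i j k i' j' k' (g : phom j k) (f : phom i j)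
    (g' : phom j' k') (f' : phom i' j') :
  pcomp (ptens g g') (ptens f f') = ptens (pcomp g f) (pcomp g' f').
Proof.
rewrite /pcomp /ptens.
elim/basis_ind: f => [|a P f IHf]; first by rewrite !(bilin0l, bilin0r).
rewrite !(bilinPl, bilinPr) IHf; congr (_ *: _ + _) => {f IHf}.
elim/basis_ind: g => [|b Q g IHg]; first by rewrite !(bilin0l, bilin0r).
rewrite !(bilinPl, bilinPr) IHg; congr (_ *: _ + _) => {g IHg}.
elim/basis_ind: f' => [|c P' f' IHf]; first by rewrite !(bilin0l, bilin0r).
rewrite !(bilinPl, bilinPr) IHf; congr (_ *: _ + _) => {f' IHf}.
elim/basis_ind: g' => [|d Q' g' IHg]; first by rewrite !(bilin0l, bilin0r).
rewrite !(bilinPl, bilinPr) IHg; congr (_ *: _ + _) => {g' IHg}.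
rewrite !bilin_basis !scale1r !bilin_basis bilinZl bilinZr bilin_basis.
have [-> ->] := diag_tens_comp Q P Q' P'.
by rewrite !scalerA exprD mulr1.
Qed.

Lemma pflipP i j c (f g : phom i j) : pflip (c *: f + g) = c *: pflip f + pflip g.
Proof. by apply/ffunP => D; rewrite !ffunE. Qed.

Lemma pflip0 i j : pflip (0 : phom i j) = 0.
Proof. by apply/ffunP => D; rewrite !ffunE. Qed.

Lemma pflip_sum i j (I : finType) (F : I -> phom i j) :
  pflip (\sum_a F a) = \sum_a pflip (F a).
Proof.
by apply/ffunP => D; rewrite !(ffunE, sum_ffunE); apply: eq_bigr => a _; rewrite ffunE.
Qed.

Lemma pflip_basis i j (P : diag i j) : pflip (basis K P) = basis K (diag_flip P).
Proof.
by apply/ffunP => D; rewrite !ffunE (can2_eq (@diag_flipK _ _) (@diag_flipK _ _)).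
Qed.

Lemma pflip_comp i j k (g : phom j k) (f : phom i j) :
  pflip (pcomp g f) = pcomp (pflip f) (pflip g).
Proof.
rewrite /pcomp.
elim/basis_ind: f => [|a P f IHf]; first by rewrite !(bilin0r, pflip0) bilin0l.
rewrite bilinPr !pflipP bilinPl IHf; congr (_ *: _ + _) => {f IHf}.
elim/basis_ind: g => [|b Q g IHg]; first by rewrite !(bilin0l, pflip0) bilin0r.
rewrite bilinPl !pflipP bilinPr IHg; congr (_ *: _ + _) => {g IHg}.
rewrite bilin_basis !pflip_basis bilin_basis.
have [-> ->] := diag_flip_comp Q P.
by apply/ffunP => D; rewrite !ffunE (can2_eq (@diag_flipK _ _) (@diag_flipK _ _)).
Qed.

(* The formal direct sum of the objects deg a, for a in idx. *)
Record fam := Fam { idx :> finType; deg : idx -> nat }.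

Definition ahom (A B : fam) :=
  {dffun forall ab : A * B, phom (deg ab.1) (deg ab.2)}.

Definition mkahom (A B : fam) (F : forall (a : A) (b : B), phom (deg a) (deg b)) :
    ahom A B :=
  @finfun _ (fun ab : A * B => phom (deg ab.1) (deg ab.2)) (fun ab => F ab.1 ab.2).

Definition entry (A B : fam) (f : ahom A B) (a : A) (b : B) :
  phom (deg a) (deg b) := f (a, b).

Lemma entryE (A B : fam) F a b : entry (@mkahom A B F) a b = F a b.
Proof. by rewrite /entry ffunE. Qed.

Lemma ahomP (A B : fam) (f g : ahom A B) :
  (forall a b, entry f a b = entry g a b) -> f = g.
Proof. by move=> H; apply/ffunP => -[a b]; apply: H. Qed.

Section AhomZmod.
Variables A B : fam.
HB.instance Definition _ := Choice.on (ahom A B).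
Let add (f g : ahom A B) : ahom A B :=
  mkahom (fun a b => entry f a b + entry g a b).
Let opp (f : ahom A B) : ahom A B := mkahom (fun a b => - entry f a b).
Let zero : ahom A B := mkahom (fun a b => 0).
Let addA : associative add.
Proof. by move=> f g h; apply: ahomP => a b; rewrite !entryE addrA. Qed.
Let addC : commutative add.
Proof. by move=> f g; apply: ahomP => a b; rewrite !entryE addrC. Qed.
Let add0 : left_id zero add.
Proof. by move=> f; apply: ahomP => a b; rewrite !entryE add0r. Qed.
Let addN : left_inverse zero opp add.
Proof. by move=> f; apply: ahomP => a b; rewrite !entryE addNr. Qed.
HB.instance Definition _ :=
  GRing.isZmodule.Build (ahom A B) addA addC add0 addN.

Lemma entryD (f g : ahom A B) a b : entry (f + g) a b = entry f a b + entry g a b.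
Proof. exact: entryE. Qed.
Lemma entryN (f : ahom A B) a b : entry (- f) a b = - entry f a b.
Proof. exact: entryE. Qed.
Lemma entry0 a b : entry (0 : ahom A B) a b = 0.
Proof. exact: entryE. Qed.
End AhomZmod.

Definition acomp (A B C : fam) (g : ahom B C) (f : ahom A B) : ahom A C :=
  mkahom (fun a c => \sum_(b : B) pcomp (entry g b c) (entry f a b)).

Definition fam_tens (A B : fam) : fam :=
  @Fam (A * B)%type (fun ab => (deg ab.1 + deg ab.2)%N).

Definition atens (A B C D : fam) (f : ahom A B) (g : ahom C D) :
    ahom (fam_tens A C) (fam_tens B D) :=
  @mkahom (fam_tens A C) (fam_tens B D)
    (fun ac bd => ptens (entry f ac.1 bd.1) (entry g ac.2 bd.2)).

(* Objects of the partition category, hence their formal direct sums, are     *)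
(* self-dual; on morphisms duality turns diagrams upside down.                *)
(* So the dual of (A, e) in the idempotent completion is (A, adual e).        *)
Definition adual (A B : fam) (f : ahom A B) : ahom B A :=
  mkahom (fun b a => pflip (entry f a b)).

Definition fam_unit : fam := @Fam unit (fun _ => 0%N).

Definition aunit : ahom fam_unit fam_unit := @mkahom fam_unit fam_unit (fun _ _ => pid 0).

Definition aev (A : fam) : ahom (fam_tens A A) fam_unit :=
  @mkahom (fam_tens A A) fam_unit
    (fun a _ => if a.1 == a.2 then pev (deg a.1) (deg a.2) else 0).

Definition aco (A : fam) : ahom fam_unit (fam_tens A A) :=
  @mkahom fam_unit (fam_tens A A)
    (fun _ a => if a.1 == a.2 then pco (deg a.1) (deg a.2) else 0).

Definition abraid (A B : fam) : ahom (fam_tens A B) (fam_tens B A) :=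
  @mkahom (fam_tens A B) (fam_tens B A)
    (fun ab ba => if (ab.1 == ba.2) && (ab.2 == ba.1)
                  then pbraid (deg ab.1) (deg ab.2) (deg ba.1) (deg ba.2)
                  else 0).

Lemma acompA (A B C D : fam) (h : ahom C D) (g : ahom B C) (f : ahom A B) :
  acomp h (acomp g f) = acomp (acomp h g) f.
Proof.
apply: ahomP => a d; rewrite !entryE.
under eq_bigr do rewrite entryE [pcomp _ _]bilin_sumr.
rewrite exchange_big; apply: eq_bigr => b _; rewrite entryE [RHS]bilin_suml.
by apply: eq_bigr => c _; apply: pcompA.
Qed.

Lemma acompBl (A B C : fam) (g1 g2 : ahom B C) (f : ahom A B) :
  acomp (g1 - g2) f = acomp g1 f - acomp g2 f.
Proof.
apply: ahomP => a c; rewrite entryD entryN !entryE -sumrN -big_split.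
apply: eq_bigr => b _; rewrite entryD entryN /pcomp bilinDl; congr (_ + _).
by rewrite -scaleN1r bilinZl scaleN1r.
Qed.

Lemma acompBr (A B C : fam) (g : ahom B C) (f1 f2 : ahom A B) :
  acomp g (f1 - f2) = acomp g f1 - acomp g f2.
Proof.
apply: ahomP => a c; rewrite entryD entryN !entryE -sumrN -big_split.
apply: eq_bigr => b _; rewrite entryD entryN /pcomp bilinDr; congr (_ + _).
by rewrite -scaleN1r bilinZr scaleN1r.
Qed.

Lemma atens_comp (A B C A' B' C' : fam) (g : ahom B C) (f : ahom A B)
    (g' : ahom B' C') (f' : ahom A' B') :
  acomp (atens g g') (atens f f') = atens (acomp g f) (acomp g' f').
Proof.
apply: ahomP => -[a a'] [c c']; rewrite !entryE /= [RHS]bilin_suml.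
under [RHS]eq_bigr do rewrite bilin_sumr.
rewrite pair_big; apply: eq_bigr => -[b b'] _.
by rewrite !entryE /= ptens_comp.
Qed.

Lemma adual_comp (A B C : fam) (g : ahom B C) (f : ahom A B) :
  adual (acomp g f) = acomp (adual f) (adual g).
Proof.
apply: ahomP => c a; rewrite !entryE pflip_sum.
by apply: eq_bigr => b _; rewrite !entryE pflip_comp.
Qed.

Lemma aunit_idem : acomp aunit aunit = aunit.
Proof.
by apply: ahomP => a b; rewrite !entryE (big_pred1 tt) ?entryE ?pid_comp //; case.
Qed.

Record obj := Obj {
  carrier : fam;
  idem : ahom carrier carrier;
  idemP : acomp idem idem = idem
}.

Definition is_hom (X Y : obj) : pred (ahom (carrier X) (carrier Y)) :=
  fun f => acomp (idem Y) (acomp f (idem X)) == f.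

Lemma is_hom_zmod_closed (X Y : obj) : zmod_closed (@is_hom X Y).
Proof.
have B : {in @is_hom X Y &, forall u v, u - v \in @is_hom X Y}.
  by move=> f g /eqP Hf /eqP Hg; apply/eqP; rewrite acompBl acompBr Hf Hg.
split=> //; apply/eqP.
have e0 : acomp (0 : ahom (carrier X) (carrier Y)) (idem X) = 0.
  by rewrite -[X in acomp X _](subrr (0 : ahom (carrier X) (carrier Y))) acompBl subrr.
rewrite e0 -[X in acomp _ X](subrr (0 : ahom (carrier X) (carrier Y))).
by rewrite acompBr subrr.
Qed.

HB.instance Definition _ (X Y : obj) :=
  GRing.isZmodClosed.Build _ (@is_hom X Y) (@is_hom_zmod_closed X Y).

Record khom (X Y : obj) := KHom {
  khom_val : ahom (carrier X) (carrier Y);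
  khomP : is_hom khom_val
}.

HB.instance Definition _ (X Y : obj) := [isSub for @khom_val X Y].
HB.instance Definition _ (X Y : obj) := [Choice of khom X Y by <:].
HB.instance Definition _ (X Y : obj) := [SubChoice_isSubZmodule of khom X Y by <:].

Lemma hom_idl (X Y : obj) (f : khom X Y) : acomp (idem Y) (khom_val f) = khom_val f.
Proof. by rewrite -(eqP (khomP f)) acompA idemP. Qed.

Lemma hom_idr (X Y : obj) (f : khom X Y) : acomp (khom_val f) (idem X) = khom_val f.
Proof. by rewrite -(eqP (khomP f)) -!acompA idemP. Qed.

Lemma sandwich_is_hom (X Y : obj) f :
  is_hom (acomp (idem Y) (acomp f (idem X)) : ahom (carrier X) (carrier Y)).
Proof. by rewrite /is_hom -!acompA idemP !acompA idemP. Qed.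

(* The morphism X -> Y induced by a morphism of the additive envelope; the    *)
(* evaluation, coevaluation and symmetry of an idempotent completion are      *)
(* induced in this way by those of the original category.                     *)
Definition sandwich (X Y : obj) (f : ahom (carrier X) (carrier Y)) : khom X Y :=
  KHom (sandwich_is_hom f).

Definition kid (X : obj) : khom X X :=
  @KHom X X (idem X) (introT eqP (etrans (congr1 _ (idemP X)) (idemP X))).

Lemma kcomp_is_hom (X Y Z : obj) (g : khom Y Z) (f : khom X Y) :
  is_hom (acomp (khom_val g) (khom_val f) : ahom (carrier X) (carrier Z)).
Proof. by rewrite /is_hom -acompA hom_idr acompA hom_idl. Qed.

Definition kcomp (X Y Z : obj) (g : khom Y Z) (f : khom X Y) : khom X Z :=
  KHom (kcomp_is_hom g f).

Lemma obj_tens_idem (X Y : obj) :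
  acomp (atens (idem X) (idem Y)) (atens (idem X) (idem Y))
  = atens (idem X) (idem Y).
Proof. by rewrite atens_comp !idemP. Qed.

Definition obj_tens (X Y : obj) : obj := Obj (obj_tens_idem X Y).

Lemma ktens_is_hom (X Y X' Y' : obj) (f : khom X Y) (g : khom X' Y') :
  @is_hom (obj_tens X X') (obj_tens Y Y') (atens (khom_val f) (khom_val g)).
Proof. by rewrite /is_hom /= !atens_comp !hom_idr !hom_idl. Qed.

Definition ktens (X Y X' Y' : obj) (f : khom X Y) (g : khom X' Y') :
    khom (obj_tens X X') (obj_tens Y Y') :=
  KHom (ktens_is_hom f g).

Definition obj_unit : obj := Obj aunit_idem.

Lemma obj_dual_idem (X : obj) :
  acomp (adual (idem X)) (adual (idem X)) = adual (idem X).
Proof. by rewrite -adual_comp idemP. Qed.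

Definition obj_dual (X : obj) : obj := Obj (obj_dual_idem X).

Definition kev (X : obj) : khom (obj_tens X (obj_dual X)) obj_unit :=
  @sandwich (obj_tens X (obj_dual X)) obj_unit (aev (carrier X)).

Definition kco (X : obj) : khom obj_unit (obj_tens (obj_dual X) X) :=
  @sandwich obj_unit (obj_tens (obj_dual X) X) (aco (carrier X)).

Definition kbraid (X Y : obj) : khom (obj_tens X Y) (obj_tens Y X) :=
  @sandwich (obj_tens X Y) (obj_tens Y X) (abraid (carrier X) (carrier Y)).

Definition ktrace (X : obj) (f : khom X X) : khom obj_unit obj_unit :=
  kcomp (kev X)
    (kcomp (kbraid (obj_dual X) X) (kcomp (ktens (kid (obj_dual X)) f) (kco X))).

Definition negligible (X Y : obj) (f : khom X Y) : Prop :=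
  forall g : khom Y X, ktrace (kcomp g f) = 0.

Definition hom_family := forall X Y : obj, khom X Y -> Prop.

Record tensor_ideal (J : hom_family) : Prop := TensorIdeal {
  ideal0 : forall X Y, J X Y 0;
  idealB : forall X Y (f g : khom X Y), J X Y f -> J X Y g -> J X Y (f - g);
  ideal_postcomp : forall X Y Z (f : khom X Y) (g : khom Y Z),
    J X Y f -> J X Z (kcomp g f);
  ideal_precomp : forall X Y Z (f : khom X Y) (g : khom Y Z),
    J Y Z g -> J X Z (kcomp g f);
  ideal_tens : forall X Y Z (f : khom X Y),
    J X Y f -> J (obj_tens Z X) (obj_tens Z Y) (ktens (kid Z) f)
}.

Definition zero_ideal : hom_family := fun X Y f => f = 0.
Definition whole_category : hom_family := fun X Y f => True.

Definition same_family (J J' : hom_family) : Prop :=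
  forall X Y (f : khom X Y), J X Y f <-> J' X Y f.

Definition nontrivial_tensor_ideal (J : hom_family) : Prop :=
  [/\ tensor_ideal J, ~ same_family J zero_ideal
    & ~ same_family J whole_category].

End Partition.

(* Main.v *)
Require Import Defs.
From HB Require Import structures.
From mathcomp Require Import all_boot all_order all_algebra.
From Stdlib Require Import Classical_Prop.

Set Implicit Arguments.
Unset Strict Implicit.
Unset Printing Implicit Defensive.

Import GRing.Theory.
Local Open Scope ring_scope.

(** Why the theorem is true.

A diagram from [i] to [j] is a set partition of its [i + j] dots. Let [f] be a
linear combination of set partitions of [T], and [c] a colouring of [T]; the
value of [f] at [c] is the sum of the coefficients of the partitions on whose
blocks [c] is constant ([value]). It depends only on the partition of [T] into
the fibres of [c], and Moebius inversion along refinement shows that [f] is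
determined by its values ([value_inj]), which can be prescribed: [indicator P]
has value 1 at the colourings whose fibres are the blocks of [P] and 0 at all
others. Hom spaces of the partition category thus become spaces of functions
on partitions, whatever the parameter [t].

Let [J] be a tensor ideal. It is determined by its morphisms between tensor
powers of the generating object ([idealP]). These are stable under pulling
values back along a map between sets of dots, and under pointwise product with
arbitrary values: both are composition of [id (x) f] with fixed morphisms
([value_transport]). So [f] is in [J] as soon as all the indicators in its
expansion are, and conversely; moreover [indicator P] is in [J] if and only if
[x_r], the indicator of injective colourings of [r] upper dots, is, where [r] is
the number of blocks of [P] ([level_of], [ideal1_of_levels]). Hence [J] is
determined by its levels, the set of those [r] with [x_r] in [J].

The set of levels is closed under successor ([levelS]). Closing off the last
dot of [x_(r+1)] gives [(t - r) x_r] ([cap_inj_indicator]): a colour different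
from [r] given distinct colours can be chosen in [t - r] ways, an identity that
makes sense for all [t]. In characteristic zero the set of levels is thus also
closed under predecessor, except possibly from [t + 1] to [t]. So it is empty,
or consists of all naturals, or of those greater than [t]. The first two cases
are the zero ideal and the whole category, hence all other tensor ideals
coincide ([nontrivial_idealP]).

It remains to see that negligible morphisms form such an ideal. As [t] is a
positive integer, taking values at colourings with [t] colours sends morphisms
to matrices ([colour_mx]), compatibly with composition, tensor products and
traces ([colour_mx_comp], [colour_mx_tens], [colour_mx_trace]). Pairing with
indicators shows that negligible means having zero matrix ([negligibleP]).
Therefore negligible morphisms form a tensor ideal; it does not contain the
identity of the unit object, and it contains the nonzero [x_(t+1)], because
[t + 1] dots have no injective colouring with [t] colours. *)

(* The composition of partial maps has the same name. *)
Local Notation pcomp := Defs.pcomp.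

(** * Values of combinations of partitions at colourings *)

Section Partitions.
Variable T : finType.
Implicit Types P Q : setpart T.

Definition block P (u : T) : {set T} := pblock (val P) u.

Lemma eq_block P u v : (block P u == block P v) = same P u v.
Proof. by rewrite same_pblockE. Qed.

Lemma compat_ker (C D : eqType) P (c : T -> C) (d : T -> D) :
  (forall u v, (c u == c v) = (d u == d v)) -> compat P c = compat P d.
Proof.
move=> cd; apply/compatP/compatP=> H u v /H/eqP.
  by rewrite cd => /eqP.
by rewrite -cd => /eqP.
Qed.

Lemma fibers_ker (C D : eqType) (c : T -> C) (d : T -> D) :
  (fibers c == fibers d) = [forall u, [forall v, (c u == c v) == (d u == d v)]].
Proof.
apply/eqP/idP => [e|/forallP H].
  by apply/forallP=> u; apply/forallP=> v; rewrite -!same_fibers e.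
by apply: setpart_ext => u v; rewrite !same_fibers; have /forallP/(_ v)/eqP := H u.
Qed.

Lemma fibers_block P : fibers (block P) = P.
Proof. by apply: setpart_ext => u v; rewrite same_fibers eq_block. Qed.

(** A measure for induction along refinement. *)
Definition nlinks P := #|[set uv : T * T | same P uv.1 uv.2]|.

Lemma nlinks_refine P Q : compat P (block Q) -> P != Q -> (nlinks P < nlinks Q)%N.
Proof.
move=> /compatP PQ nPQ; apply: proper_card; rewrite properEneq.
have sPQ : [set uv : T * T | same P uv.1 uv.2] \subset [set uv | same Q uv.1 uv.2].
  by apply/subsetP=> -[u v]; rewrite !inE /= => /PQ/eqP; rewrite eq_block.
rewrite sPQ andbT; apply: contraNneq nPQ => /setP e.
by apply/eqP/setpart_ext => u v; have := e (u, v); rewrite !inE.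
Qed.

Lemma compat_block P : compat P (block P).
Proof. by apply/compatP=> u v; rewrite -eq_block => /eqP. Qed.

End Partitions.

(** Sealed, like [value] and [transport] below, so that distinct diagrams are
    never compared by unfolding the vectors built from them. *)
HB.lock Definition dvec (K : comNzRingType) (T : finType) (P : setpart T) :
  {ffun setpart T -> K^o} := basis K P.

Lemma dvec_ind (K : comNzRingType) (T : finType)
    (Pr : {ffun setpart T -> K^o} -> Prop) :
  Pr 0 -> (forall c P f, Pr f -> Pr (c *: dvec K P + f)) -> forall f, Pr f.
Proof. by move=> P0 PD; apply: basis_ind => // c P f /PD; rewrite dvec.unlock. Qed.

Lemma bilin_dvec (K : comNzRingType) (A B C : finType) (w : setpart A -> setpart B -> K)
    (op : setpart A -> setpart B -> setpart C) P Q :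
  bilin w op (dvec K P) (dvec K Q) = w P Q *: dvec K (op P Q).
Proof. by rewrite dvec.unlock bilin_basis. Qed.

HB.lock Definition value (K : fieldType) (T : finType) (C : eqType)
    (f : {ffun setpart T -> K^o}) (c : T -> C) : K :=
  \sum_P (f P : K) * (compat P c)%:R.

Section Value.
Variables (K : fieldType) (T : finType).
Implicit Types (P Q : setpart T) (f g : {ffun setpart T -> K^o}).

Lemma value_ker (C D : eqType) f (c : T -> C) (d : T -> D) :
  (forall u v, (c u == c v) = (d u == d v)) -> value f c = value f d.
Proof.
by move=> cd; rewrite value.unlock; apply: eq_bigr => P _; rewrite (compat_ker P cd).
Qed.

Lemma eq_value (C : eqType) f (c d : T -> C) : c =1 d -> value f c = value f d.
Proof. by move=> cd; apply: value_ker => u v; rewrite !cd. Qed.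

Lemma value_dvec (C : eqType) P (c : T -> C) :
  value (dvec K P) c = (compat P c)%:R.
Proof.
rewrite dvec.unlock value.unlock (bigD1 P) //= big1 ?addr0 => [|Q nQ];
  rewrite ffunE ?eqxx ?mul1r //.
by rewrite (negbTE nQ) mul0r.
Qed.

Lemma valueP (C : eqType) (a : K) f g (c : T -> C) :
  value (a *: f + g) c = a * value f c + value g c.
Proof.
rewrite value.unlock big_distrr -big_split /=; apply: eq_bigr => P _.
by rewrite !ffunE mulrDl mulrA.
Qed.

Lemma value0 (C : eqType) (c : T -> C) : value (0 : {ffun setpart T -> K^o}) c = 0.
Proof. by rewrite value.unlock big1 // => P _; rewrite ffunE mul0r. Qed.

Lemma valueZ (C : eqType) (a : K) f (c : T -> C) : value (a *: f) c = a * value f c.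
Proof. by have := valueP a f 0 c; rewrite !addr0 value0 addr0. Qed.

Lemma valueD (C : eqType) f g (c : T -> C) : value (f + g) c = value f c + value g c.
Proof. by have := valueP 1 f g c; rewrite scale1r mul1r. Qed.

Lemma valueN (C : eqType) f (c : T -> C) : value (- f) c = - value f c.
Proof. by rewrite -scaleN1r valueZ mulN1r. Qed.

Lemma value_sum (C : eqType) (I : finType) (F : I -> {ffun setpart T -> K^o})
    (c : T -> C) :
  value (\sum_i F i) c = \sum_i value (F i) c.
Proof. exact: (big_morph (fun f => value f c) (fun f g => valueD f g c) (value0 c)). Qed.

(** The value at [P] is [f P] plus the coefficients of the strict refinements of
    [P], which vanish by induction. *)
Lemma value_eq0 f : (forall P, value f (block P) = 0) -> f = 0.
Proof.
move=> f0; apply/ffunP=> P; rewrite ffunE.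
have [n] := ubnP (nlinks P); elim: n P => // n IH P leP.
have := f0 P; rewrite value.unlock (bigD1 P) //= compat_block mulr1.
rewrite big1 ?addr0 // => Q nQP.
have [QP|_] := boolP (compat Q (block P)); last by rewrite mulr0.
by rewrite IH ?mul0r // (leq_trans (nlinks_refine QP nQP)).
Qed.

Lemma value_inj f g : (forall P, value f (block P) = value g (block P)) -> f = g.
Proof.
move=> fg; apply/eqP; rewrite -subr_eq0; apply/eqP/value_eq0 => P.
by rewrite valueD valueN fg subrr.
Qed.

(** Moebius inversion: the basis vector [P] has value 1 exactly at [P] and its
    coarsenings, so subtract the indicators of the strict coarsenings. *)
Lemma indicator_exists P :
  exists f, [forall Q, value f (block Q) == (Q == P)%:R].
Proof.
have [n] := ubnP (#|{: T * T}| - nlinks P).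
elim: n P => // n IH P leP.
have coarser Q : exists f, compat P (block Q) && (Q != P) ->
    [forall R, value f (block R) == (R == Q)%:R].
  have [/andP[PQ nQP]|] := boolP (_ && _); last by exists 0.
  have ltPQ : (nlinks P < nlinks Q)%N by rewrite nlinks_refine // eq_sym.
  have [|f] := IH Q; last by exists f.
  rewrite ltnS in leP; apply: leq_trans leP; rewrite ltn_sub2l //.
  exact: leq_trans ltPQ (max_card _).
have [F HF] := fin_all_exists coarser.
exists (dvec K P - \sum_(Q | compat P (block Q) && (Q != P)) F Q).
apply/forallP=> R; rewrite big_mkcond valueD valueN value_sum value_dvec.
rewrite (eq_bigr (fun Q => (compat P (block Q) && (Q != P))%:R * (R == Q)%:R))
  => [|Q _]; last first.
  have := HF Q; case: ifP => [_ /(_ isT)/forallP/(_ R)/eqP->|_ _].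
    by rewrite mul1r.
  by rewrite value0 mul0r.
rewrite (bigD1 R) //= big1 ?addr0 => [|Q nQR]; last first.
  by rewrite [R == Q]eq_sym (negbTE nQR) mulr0.
apply/eqP; rewrite eqxx mulr1; case: (R =P P) => [->|_].
  by rewrite compat_block andbF subr0.
by rewrite andbT subrr.
Qed.

Definition indicator P := xchoose (indicator_exists P).

Lemma value_indicator (C : eqType) P (c : T -> C) :
  value (indicator P) c = (fibers c == P)%:R.
Proof.
have /forallP/(_ (fibers c))/eqP <- := xchooseP (indicator_exists P).
by apply: value_ker => u v; rewrite eq_block same_fibers.
Qed.

End Value.

(** * Reshaping morphisms inside a tensor ideal *)

Lemma compat_pullback (T D : finType) (C : eqType) (Q : setpart D)
    (lab : T -> D) (sec : D -> T) (c : T -> C) : cancel sec lab ->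
  compat (fibers (block Q \o lab)) c =
  compat Q (c \o sec) && [forall u, c u == c (sec (lab u))].
Proof.
move=> secK; apply/compatP/andP => [H|[/compatP cQ /forallP cs] u v].
  split; last by apply/forallP=> u; apply/eqP/H; rewrite same_fibers /= secK.
  by apply/compatP=> u v uv; apply: H; rewrite same_fibers /= !secK eq_block.
by rewrite same_fibers /= eq_block (eqP (cs u)) (eqP (cs v)); apply: cQ.
Qed.

Lemma compat_fibers (T : finType) (D C : eqType)
    (lab : T -> D) (sec : D -> T) (c : T -> C) : cancel sec lab ->
  compat (fibers lab) c = [forall u, c u == c (sec (lab u))].
Proof.
move=> secK; apply/compatP/forallP => [H u|H u v].
  by apply/eqP/H; rewrite same_fibers secK.
by rewrite same_fibers (eqP (H u)) (eqP (H v)) => /eqP->.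
Qed.

Lemma split_lshift m n (a : 'I_m) : split (lshift n a) = inl a.
Proof. exact: (unsplitK (inl a)). Qed.
Lemma split_rshift m n (a : 'I_n) : split (rshift m a) = inr a.
Proof. exact: (unsplitK (inr a)). Qed.

Lemma row_cat_ext (C : Type) m n (x y : 'I_(m + n) -> C) :
  (forall a, x (lshift n a) = y (lshift n a)) ->
  (forall b, x (rshift m b) = y (rshift m b)) -> x =1 y.
Proof. by move=> l r a; rewrite -(splitK a); case: (split a). Qed.

Section Transport.
Variables (i j i' j' : nat) (p : 'I_i + 'I_j -> 'I_i' + 'I_j').

(** The transport of [f : i -> j] along [p] is the composite
    i' -> i' + i + i -> i' + i + j -> j'
    of [bend], [id (x) f] and [rewire]. Bending creates a copy of the lower row
    of [f] that remains accessible above [f]; so rewiring can attach both rows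
    of [f], along [p], to the dots of [i'] and [j'], whatever row [p] sends
    them to. It also imposes the partition [Q] on these. *)
Definition unbend_label (u : 'I_i' + 'I_(i' + i + i)) : 'I_i' + 'I_i :=
  match u with
  | inl a => inl a
  | inr m => match split m with inl k => split k | inr b => inr b end
  end.

Definition bend : diag i' (i' + i + i) := fibers unbend_label.

Definition rewire_label (u : 'I_(i' + i + j) + 'I_j') : 'I_i' + 'I_j' :=
  match u with
  | inl m => match split m with
             | inl k => match split k with inl a => inl a | inr b => p (inl b) end
             | inr b => p (inr b)
             end
  | inr b => inr b
  end.

Definition rewire (Q : diag i' j') : diag (i' + i + j) j' :=
  fibers (block Q \o rewire_label).

Definition whisker (P : diag i j) : diag (i' + i + i) (i' + i + j) :=
  diag_tens (diag_id 'I_(i' + i)) P.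

Definition transport_diag (Q : diag i' j') (P : diag i j) : diag i' j' :=
  diag_comp (rewire Q) (diag_comp (whisker P) bend).

Section Colours.
Variables (C : finType) (c0 : C) (Q : diag i' j') (P : diag i j).
Variables (x : 'I_i' -> C) (z : 'I_j' -> C).

(** In the sum over colourings of the two inner rows only one term survives:
    all inner dots are linked to dots of the outer rows. *)
Lemma transport_count :
  (compat (transport_diag Q P) (sumf x z)
     * #|C| ^ (nloops (rewire Q) (diag_comp (whisker P) bend)
               + nloops (whisker P) bend)
   = compat P (sumf x z \o p) && compat Q (sumf x z))%N.
Proof.
rewrite expnD mulnA -(count_compat c0) big_distrl /=.
under eq_bigr do rewrite mulnAC -(count_compat c0) big_distrl /=.
rewrite pair_big /=.
(* The colours of the two inner rows that are forced by [x] and [z]. *)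
pose inner (m : 'I_(i' + i + i)) := match split m with
   | inl k => match split k with inl a => inl a | inr b => p (inl b) end
   | inr b => p (inl b) end.
pose y0 := [ffun m => sumf x z (rewire_label (inl m))].
pose m0 := [ffun m => sumf x z (inner m)].
pose secV (u : 'I_i' + 'I_j') : 'I_(i' + i + j) + 'I_j' :=
  match u with inl a => inl (lshift _ (lshift _ a)) | inr b => inr b end.
pose secU (u : 'I_i' + 'I_i) : 'I_i' + 'I_(i' + i + i) :=
  match u with inl a => inl a | inr b => inr (rshift _ b) end.
have secVK : cancel secV rewire_label.
  by case=> a //=; rewrite !split_lshift.
have secUK : cancel secU unbend_label by case=> a //=; rewrite split_rshift.
rewrite (bigD1 (y0, m0)) //= big1 ?addn0 => [|[y m] /= nym].
  rewrite (compat_fibers _ secUK) compat_tens compat_id (compat_pullback _ _ secVK).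
  have -> : [forall u, sumf x m0 u == sumf x m0 (secU (unbend_label u))].
    apply/forallP=> -[a|m] //=; apply/eqP; rewrite ffunE /inner.
    case: (split m) => [k|b] /=; first case: (split k) => [a|b] //=.
      by rewrite ffunE /inner split_rshift.
    by rewrite ffunE /inner split_rshift.
  have -> : [forall k, m0 (lshift i k) == y0 (lshift j k)].
    by apply/forallP=> k; rewrite !ffunE /inner /= !split_lshift.
  have -> : [forall u, sumf y0 z u == sumf y0 z (secV (rewire_label u))].
    have secVE d : sumf y0 z (secV d) = sumf x z d.
      by case: d => //= a; rewrite ffunE /= !split_lshift.
    by apply/forallP=> -[m|b]; rewrite secVE // [sumf y0 z _]ffunE.
  rewrite mul1n andTb andbT mulnb; congr (nat_of_bool (_ && _)).
    by apply: eq_compat; case=> a /=; rewrite ffunE /inner /= ?split_rshift.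
  by apply: eq_compat; case=> a //=; rewrite ffunE /inner /= ?split_lshift.
apply/eqP; rewrite !muln_eq0 !eqb0 -!negb_and; apply: contra nym.
rewrite (compat_fibers _ secUK) compat_tens compat_id (compat_pullback _ _ secVK).
case/andP=> /andP[/forallP U /andP[/forallP W _]] /andP[_ /forallP V].
have mx a : m (lshift i (lshift i a)) = x a.
  by have /= := eqP (U (inr (lshift i (lshift i a)))); rewrite !split_lshift.
have yx a : y (lshift j (lshift i a)) = x a by rewrite -mx (eqP (W _)).
have yE : y = y0.
  apply/ffunP=> k; have /= := eqP (V (inl k)); rewrite ffunE => ->.
  by rewrite /=; case: (match split k with inl _ => _ | inr _ => _ end) => //= a.
have mE : m = m0.
  have mr b : m (lshift i (rshift i' b)) = m (rshift _ b).
    have /= := eqP (U (inr (lshift i (rshift i' b)))).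
    by rewrite split_lshift split_rshift.
  apply/ffunP; apply: row_cat_ext => [|b]; first apply: row_cat_ext => [a|b].
  - by rewrite mx ffunE /inner !split_lshift.
  - by rewrite (eqP (W _)) yE !ffunE /inner /= !split_lshift split_rshift.
  - by rewrite -mr (eqP (W _)) yE !ffunE /inner /= split_lshift !split_rshift.
by rewrite yE mE.
Qed.
End Colours.

(** With two available colours and a constant colouring of the outer dots, both
    indicators in [transport_count] are 1; what remains is a power of 2, counting
    the colourings of the loops, that must be 1. *)
Lemma transport_loops (Q : diag i' j') (P : diag i j) :
  (nloops (whisker P) bend = 0)%N /\
  (nloops (rewire Q) (diag_comp (whisker P) bend) = 0)%N.
Proof.
have := transport_count true Q P (fun=> true) (fun=> true).
have triv (T : finType) (R : setpart T) (c : T -> bool) : (c =1 fun=> true) -> compat R c.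
  by move=> c1; apply/compatP => u v _; rewrite !c1.
rewrite !triv ?mul1n; try by move=> [] /=.
  move=> /eqP; rewrite card_bool -[(_ && _ : nat)]/(2 ^ 0)%N eqn_exp2l // addn_eq0.
  by case/andP=> /eqP-> /eqP->.
by move=> u /=; case: (p u).
Qed.

Lemma compat_transport (C : finType) (Q : diag i' j') (P : diag i j)
    (c : 'I_i' + 'I_j' -> C) :
  compat (transport_diag Q P) c = compat P (c \o p) && compat Q c.
Proof.
have [a _|C0] := pickP (@predT C); last first.
  have e (u : 'I_i' + 'I_j') : False by have := C0 (c u).
  have e' (u : 'I_i + 'I_j) : False by apply: (e (p u)).
  rewrite [LHS](introT (compatP _ _)); last by move=> u; case: (e u).
  rewrite [X in X && _](introT (compatP _ _)); last by move=> u; case: (e' u).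
  by rewrite [RHS](introT (compatP _ _)); last by move=> u; case: (e u).
have [l1 l2] := transport_loops Q P.
have := transport_count a Q P (fun a => c (inl a)) (fun b => c (inr b)).
rewrite l1 l2 muln1 !(eq_compat _ (sumfE c)).
have -> : compat P (sumf (fun a => c (inl a)) (fun b => c (inr b)) \o p) = compat P (c \o p).
  by apply: eq_compat => u; apply: sumfE.
by case: (compat (transport_diag _ _) c); case: (_ && _).
Qed.

End Transport.

(** [transport_diag p] extended linearly in both arguments, in a form that
    shows that it preserves tensor ideals. *)
HB.lock Definition transport (K : fieldType) (t : K) (i j i' j' : nat)
    (p : 'I_i + 'I_j -> 'I_i' + 'I_j') (h : phom K i' j') (f : phom K i j) :
    phom K i' j' :=
  pcomp t (\sum_Q (h Q : K) *: dvec K (rewire p Q))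
    (pcomp t (ptens (dvec K (diag_id 'I_(i' + i))) f) (dvec K (bend i i'))).

Section ValueTransport.
Variables (K : fieldType) (t : K) (i j i' j' : nat).
Variable p : 'I_i + 'I_j -> 'I_i' + 'I_j'.

Lemma value_transport_fin (C : finType) (h : phom K i' j') (f : phom K i j)
    (c : 'I_i' + 'I_j' -> C) :
  value (transport t p h f) c = value f (c \o p) * value h c.
Proof.
rewrite transport.unlock /pcomp /ptens.
elim/dvec_ind: f => [|a P f IHf].
  by rewrite !(bilin0r, bilin0l) !value0 mul0r.
rewrite !(bilinPl, bilinPr) !valueP IHf mulrDl -mulrA; congr (_ * _ + _) => {f IHf}.
rewrite bilin_dvec scale1r bilin_dvec bilinZr.
have [-> _] := transport_loops p (fibers id) P.
rewrite scale1r bilin_suml value_sum.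
under eq_bigr => Q _.
  rewrite bilinZl bilin_dvec; have [_ ->] := transport_loops p Q P.
  rewrite scale1r valueZ value_dvec -[diag_comp _ _]/(transport_diag p Q P).
  rewrite compat_transport -mulnb natrM mulrCA; over.
by rewrite -mulr_sumr value_dvec value.unlock.
Qed.

(** Pull back along [p], then multiply pointwise by [h]. No loops are involved,
    so this holds for any number of colours, whatever [t] is. *)
Lemma value_transport (C : eqType) (h : phom K i' j') (f : phom K i j)
    (c : 'I_i' + 'I_j' -> C) :
  value (transport t p h f) c = value f (c \o p) * value h c.
Proof.
have cK u v : (c u == c v) = (block (fibers c) u == block (fibers c) v).
  by rewrite eq_block same_fibers.
rewrite (value_ker _ cK) (value_ker h cK) value_transport_fin; congr (_ * _).
by apply: value_ker => u v; rewrite /= cK.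
Qed.
End ValueTransport.

(** * Indicators of injective colourings *)

Section Discrete.
Variables (K : fieldType).

Definition discrete (T : finType) : setpart T := fibers (@id T).

Lemma compat_discrete (T : finType) (C : eqType) (c : T -> C) : compat (discrete T) c.
Proof. by apply/compatP=> u v; rewrite same_fibers => /eqP->. Qed.

Lemma fibers_discrete (T : finType) (C : eqType) (c : T -> C) :
  (fibers c == discrete T) = injectiveb c.
Proof.
rewrite fibers_ker; apply/forallP/injectiveP => [H u v cuv|ci u].
  by have /forallP/(_ v) := H u; rewrite cuv eqxx => /eqP/esym/eqP.
by apply/forallP=> v; rewrite (inj_eq ci).
Qed.

Definition inj_indicator (r : nat) : phom K 0 r :=
  indicator K (discrete ('I_0 + 'I_r)%type).

Lemma value_inj_indicator (C : eqType) r (c : 'I_0 + 'I_r -> C) :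
  value (inj_indicator r) c = (injectiveb c)%:R.
Proof. by rewrite value_indicator fibers_discrete. Qed.

End Discrete.

Section Cap.
Variable r : nat.

Definition add_last (u : 'I_0 + 'I_r) : 'I_0 + 'I_r.+1 :=
  match u with inl a => inl a | inr b => inr (lift ord_max b) end.

Definition cap_label (u : 'I_r.+1 + 'I_r) : 'I_r.+1 :=
  match u with inl a => a | inr b => lift ord_max b end.

(** The last lower dot is a block by itself; the others go straight up. *)
Definition cap : diag r.+1 r := fibers cap_label.

Definition glue_label (i : 'I_r) (u : 'I_0 + 'I_r.+1) : 'I_0 + 'I_r :=
  match u with inl a => inl a | inr b => inr (odflt i (unlift ord_max b)) end.

Definition glue_last (i : 'I_r) : diag 0 r.+1 := fibers (glue_label i).

Lemma glue_labelK i : cancel add_last (glue_label i).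
Proof. by case=> //= b; rewrite liftK. Qed.

Lemma compat_glue_last (C : eqType) i (c : 'I_0 + 'I_r.+1 -> C) :
  compat (glue_last i) c = (c (inr ord_max) == c (inr (lift ord_max i))).
Proof.
rewrite (compat_fibers _ (@glue_labelK i)); apply/forallP/idP => [H|/eqP H [[]|b] //=].
  by have := H (inr ord_max); rewrite /= unlift_none.
by case: unliftP => [k ->|->] //=; rewrite H.
Qed.

Definition append (C : Type) (z : 'I_r -> C) (a : C) : 'I_r.+1 -> C :=
  fun b => oapp z a (unlift ord_max b).

(** Capping sums over the colour of the last dot. *)
Lemma cap_count (Q : diag 0 r.+1) (P : diag 0 r) (x : 'I_0 -> bool) (z : 'I_r -> bool) :
  (compat (diag_comp cap (transport_diag add_last Q P)) (sumf x z)
     * 2 ^ nloops cap (transport_diag add_last Q P)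
   = compat P (sumf x z) * \sum_(b : bool) compat Q (sumf x (append z b)))%N.
Proof.
rewrite (count2 cap) big_distrr /=.
have capE y : compat cap (sumf y z) = [forall b, y (lift ord_max b) == z b].
  rewrite (compat_fibers (sec := inl)) //; apply/forallP/forallP => H.
    by move=> b; have := H (inr b); rewrite eq_sym.
  by case=> a //=; rewrite eq_sym.
rewrite (bigID (fun y : {ffun 'I_r.+1 -> bool} => compat cap (sumf y z))) /=.
rewrite [X in (_ + X)%N]big1 ?addn0 => [|y /negbTE->]; last by rewrite muln0.
rewrite (reindex_onto (fun b => finfun (append z b)) (fun y => y ord_max)) /=.
  apply: eq_big => [b|b _].
    rewrite capE ffunE /append unlift_none eqxx andbT.
    by apply/forallP=> a; rewrite ffunE liftK.
  rewrite capE (introT forallP) ?muln1; last by move=> a; rewrite ffunE /append liftK.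
  rewrite compat_transport -mulnb; congr (nat_of_bool _ * nat_of_bool _)%N;
    apply: eq_compat.
    by case=> a //=; rewrite ffunE /append liftK.
  by case=> a //=; rewrite ffunE.
move=> y; rewrite capE => /forallP H; apply/ffunP=> b; rewrite ffunE /append.
by case: unliftP => [k ->|->] //=; rewrite (eqP (H k)).
Qed.

Lemma cap_discrete P :
  diag_comp cap (transport_diag add_last (discrete _) P) = P /\
  nloops cap (transport_diag add_last (discrete _) P) = 1%N.
Proof.
by apply: diag_ext => x z; rewrite cap_count big_bool !compat_discrete.
Qed.

Lemma cap_glue_last i P :
  diag_comp cap (transport_diag add_last (glue_last i) P) = P /\
  nloops cap (transport_diag add_last (glue_last i) P) = 0%N.
Proof.
apply: diag_ext => x z; rewrite cap_count big_bool !compat_glue_last /append /=.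
by rewrite unlift_none liftK /=; case: (z i).
Qed.

Variables (K : fieldType) (t : K).

Lemma transport_basis (Q : diag 0 r.+1) (P : diag 0 r) :
  transport t add_last (dvec K Q) (dvec K P) = dvec K (transport_diag add_last Q P).
Proof.
apply: value_inj => R; rewrite value_transport !value_dvec compat_transport.
by rewrite -natrM mulnb.
Qed.

Lemma transport_linear (h : phom K 0 r.+1) a (f g : phom K 0 r) :
  transport t add_last h (a *: f + g)
  = a *: transport t add_last h f + transport t add_last h g.
Proof.
by apply: value_inj => R; rewrite valueP !value_transport valueP mulrDl mulrA.
Qed.

Lemma cap_transport (Q : diag 0 r.+1) (e : nat) (f : phom K 0 r) :
  (forall P, diag_comp cap (transport_diag add_last Q P) = P /\
             nloops cap (transport_diag add_last Q P) = e) ->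
  pcomp t (dvec K cap) (transport t add_last (dvec K Q) f) = t ^+ e *: f.
Proof.
move=> H; rewrite /pcomp; elim/dvec_ind: f => [|a P f IH].
  have -> : transport t add_last (dvec K Q) 0 = 0.
    by apply: value_inj => R; rewrite value_transport !value0 mul0r.
  by rewrite bilin0r scaler0.
rewrite transport_linear bilinPr IH scalerDr transport_basis bilin_dvec.
by have [-> ->] := H P; rewrite !scalerA mulrC.
Qed.

(** Multiplying by it forces the last colour to differ from the previous ones,
    provided that these are distinct: at most one of the terms of the sum then
    contributes. *)
Definition fresh_last : phom K 0 r.+1 :=
  dvec K (discrete _) - \sum_i dvec K (glue_last i).

(** An injective colouring of [r.+1] dots is an injective colouring of the first
    [r] dots with a fresh last colour. *)
Lemma inj_indicatorS :
  inj_indicator K r.+1 = transport t add_last fresh_last (inj_indicator K r).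
Proof.
apply: value_inj => R; set c := block R.
rewrite value_transport !value_inj_indicator valueD valueN value_sum value_dvec.
rewrite compat_discrete.
under eq_bigr do rewrite value_dvec compat_glue_last.
have [ci|] := boolP (injectiveb (c \o add_last)); last first.
  move=> nci; rewrite mul0r; case: injectiveP => // ci; case/negP: nci.
  apply/injectiveP/inj_comp => // -[[m lt0]|a]; first by [].
  case=> [[m lt0]|b]; first by [].
  by move=> e; rewrite (lift_inj (inr_inj e)).
rewrite mul1r; have {}ci := injectiveP _ ci.
have [/existsP[i /eqP ei]|/existsPn ni] :=
  boolP [exists i, c (inr ord_max) == c (inr (lift ord_max i))].
  rewrite (bigD1 i) //= big1 ?addr0 => [|k nki].
    rewrite ei eqxx subrr; case: injectiveP => // inj_c.
    by have /eqP := inr_inj (inj_c _ _ ei); rewrite (negbTE (neq_lift _ _)).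
  rewrite ei; case: eqP => // eik; case/eqP: nki.
  exact: esym (inr_inj (ci (inr i) (inr k) eik)).
rewrite big1 ?subr0 => [|i _]; last by rewrite (negbTE (ni i)).
case: injectiveP => // -[] [[]//|a] [[]//|b].
case: (unliftP ord_max a) => [k ->|->]; case: (unliftP ord_max b) => [l ->|->] //.
- by move=> ekl; rewrite (inr_inj (ci (inr k) (inr l) ekl)).
- by move=> /esym/eqP; rewrite (negbTE (ni k)).
- by move=> /eqP; rewrite (negbTE (ni l)).
Qed.

(** The free last dot closes to a loop, of weight [t]; gluing it to one of the
    [r] others and capping it gives back [inj_indicator K r] each time. *)
Lemma cap_inj_indicator :
  pcomp t (dvec K cap) (inj_indicator K r.+1) = (t - r%:R) *: inj_indicator K r.
Proof.
have transportB (f : phom K 0 r) :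
  transport t add_last fresh_last f = transport t add_last (dvec K (discrete _)) f
    - \sum_i transport t add_last (dvec K (glue_last i)) f.
  apply: value_inj => R.
  rewrite value_transport /fresh_last !(valueD, valueN) !value_sum.
  under [X in _ = _ - X]eq_bigr do rewrite value_transport.
  by rewrite value_transport mulrBr mulr_sumr.
rewrite inj_indicatorS transportB /pcomp bilinDr -scaleN1r bilinZr bilin_sumr.
rewrite -/(pcomp t _ _) (cap_transport _ cap_discrete) expr1.
under eq_bigr => i _.
  rewrite -/(pcomp t _ _) (cap_transport _ (cap_glue_last i)) scale1r; over.
by rewrite sumr_const card_ord scaleN1r scalerBl scaler_nat.
Qed.

End Cap.

(** * Tensor ideals are determined by morphisms between single degrees *)

Section OneObject.
Variables (K : fieldType) (t : K).

Lemma pcomp_id i j (f : phom K i j) : pcomp t f (pid K i) = f.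
Proof.
have flipK k l : cancel (@pflip K k l) (@pflip K l k).
  by move=> g; apply/ffunP=> D; rewrite !ffunE diag_flipK.
have flip_id : pflip (pid K i) = pid K i.
  rewrite pflip_basis; congr basis; apply: setpart_ext => u v.
  by rewrite same_flip !same_fibers; case: u v => [a|a] [b|b].
by apply: (can_inj (flipK _ _)); rewrite pflip_comp flip_id pid_comp.
Qed.

Lemma pcomp0l i j k (f : phom K i j) : pcomp t (0 : phom K j k) f = 0.
Proof. exact: bilin0l. Qed.
Lemma pcomp0r i j k (g : phom K j k) : pcomp t g (0 : phom K i j) = 0.
Proof. exact: bilin0r. Qed.

Lemma sum_unit (V : nmodType) (F : unit -> V) : \sum_u F u = F tt.
Proof. by rewrite (big_pred1 tt) // => -[]. Qed.

Definition fam1 (i : nat) : fam := @Fam unit (fun=> i).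

Definition single i j (f : phom K i j) : ahom K (fam1 i) (fam1 j) :=
  @mkahom K (fam1 i) (fam1 j) (fun _ _ => f).

Lemma acomp_single i j k (g : phom K j k) (f : phom K i j) :
  acomp t (single g) (single f) = single (pcomp t g f).
Proof. by apply: ahomP => a b; rewrite !entryE sum_unit !entryE. Qed.

Lemma obj1_idem i : acomp t (single (pid K i)) (single (pid K i)) = single (pid K i).
Proof. by rewrite acomp_single pid_comp. Qed.

Definition obj1 i : obj t := Obj (obj1_idem i).

Lemma single_is_hom i j (f : phom K i j) : @is_hom K t (obj1 i) (obj1 j) (single f).
Proof. by rewrite /is_hom !acomp_single pid_comp pcomp_id. Qed.

Definition emb i j (f : phom K i j) : khom (obj1 i) (obj1 j) :=
  KHom (single_is_hom f).

Lemma khom_inj (X Y : obj t) (f g : khom X Y) :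
  (forall a b, entry (khom_val f) a b = entry (khom_val g) a b) -> f = g.
Proof. by move=> fg; apply: val_inj; apply: ahomP. Qed.

(** The identity when [i = j]; two indices avoid transporting along an equality
    of degrees. *)
Definition straight i j : diag i j :=
  fibers (fun u => match u with inl a => val a | inr b => val b end).

Lemma straight_id i : straight i i = diag_id 'I_i.
Proof.
by apply: setpart_ext => u v; rewrite !same_fibers; case: u v => [a|a] [b|b].
Qed.

Definition iota1 (A : fam) (a : A) : ahom K (fam1 (deg a)) A :=
  @mkahom K (fam1 (deg a)) A
    (fun _ a' => if a' == a then basis K (straight (deg a) (deg a')) else 0).

Definition proj1 (A : fam) (a : A) : ahom K A (fam1 (deg a)) :=
  @mkahom K A (fam1 (deg a))
    (fun a' _ => if a' == a then basis K (straight (deg a') (deg a)) else 0).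

Lemma entry_iota1 (A B : fam) (f : ahom K A B) (a : A) u b :
  entry (acomp t f (iota1 a)) u b = entry f a b.
Proof.
rewrite entryE (bigD1 a) //= big1 ?addr0 => [|a' /negbTE na].
  by rewrite entryE eqxx straight_id pcomp_id.
by rewrite entryE na pcomp0r.
Qed.

Lemma entry_proj1 (A B : fam) (f : ahom K A B) (b : B) a u :
  entry (acomp t (proj1 b) f) a u = entry f a b.
Proof.
rewrite entryE (bigD1 b) //= big1 ?addr0 => [|b' /negbTE nb].
  by rewrite entryE eqxx straight_id pid_comp.
by rewrite entryE nb pcomp0l.
Qed.

Definition kiota (X : obj t) (a : carrier X) : khom (obj1 (deg a)) X :=
  @sandwich K t (obj1 (deg a)) X (iota1 a).

Definition kproj (X : obj t) (a : carrier X) : khom X (obj1 (deg a)) :=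
  @sandwich K t X (obj1 (deg a)) (proj1 a).

Lemma single_id_comp (A : fam) i (f : ahom K A (fam1 i)) :
  acomp t (single (pid K i)) f = f.
Proof. by apply: ahomP => a []; rewrite entryE sum_unit entryE pid_comp. Qed.

Lemma comp_single_id (A : fam) i (f : ahom K (fam1 i) A) :
  acomp t f (single (pid K i)) = f.
Proof. by apply: ahomP => -[] a; rewrite entryE sum_unit entryE pcomp_id. Qed.

Lemma emb_entry (X Y : obj t) (f : khom X Y) a b :
  kcomp (kproj b) (kcomp f (kiota a)) = emb (entry (khom_val f) a b).
Proof.
apply: khom_inj => -[] []; rewrite /= single_id_comp comp_single_id.
rewrite -!acompA (acompA t (khom_val f)) hom_idr (acompA t (idem Y)) hom_idl.
by rewrite entry_proj1 entry_iota1 entryE.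
Qed.

Lemma khom_val_sum (X Y : obj t) (I : finType) (F : I -> khom X Y) :
  khom_val (\sum_i F i) = \sum_i khom_val (F i).
Proof. by apply: (big_morph (@khom_val K t X Y)). Qed.

Lemma entry_sum (A B : fam) (I : finType) (F : I -> ahom K A B) a b :
  entry (\sum_i F i) a b = \sum_i entry (F i) a b.
Proof.
by apply: (big_morph (fun f => entry f a b)) => [f g|]; rewrite ?entryD ?entry0.
Qed.

(** Inclusions and projections of summands express a matrix by its entries. *)
Lemma matrix_units (A B : fam) (f : ahom K A B) :
  f = \sum_(ab : A * B)
        acomp t (iota1 ab.2) (acomp t (single (entry f ab.1 ab.2)) (proj1 ab.1)).
Proof.
apply: ahomP => a b; rewrite entry_sum (bigD1 (a, b)) //= big1 ?addr0.
  rewrite entryE sum_unit entryE eqxx straight_id -/(pid _ _) pid_comp.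
  by rewrite entryE sum_unit !entryE eqxx straight_id -/(pid _ _) pcomp_id.
move=> [a' b'] /=; rewrite xpair_eqE => nab.
rewrite entryE sum_unit !entryE; case: eqP => [eb|_]; last by rewrite pcomp0l.
rewrite sum_unit !entryE; case: eqP => [ea|_]; last by rewrite !pcomp0r.
by rewrite ea eb !eqxx in nab.
Qed.

Lemma sum_sub (U V : zmodType) (h : U -> V) (I : finType) (F : I -> U) :
  {morph h : x y / x - y} -> h (\sum_i F i) = \sum_i h (F i).
Proof.
move=> hB; have h0 : h 0 = 0 by rewrite -(subrr 0) hB subrr.
have hD : {morph h : x y / x + y}.
  by move=> x y; rewrite -{1}[y]opprK -[- y]sub0r !hB h0 sub0r opprK.
exact: (big_morph h hD h0).
Qed.

Section Ideal.
Variables (J : hom_family t) (idJ : tensor_ideal J).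

Lemma ideal_sum (X Y : obj t) (I : finType) (F : I -> khom X Y) :
  (forall i, J (F i)) -> J (\sum_i F i).
Proof.
move=> JF; apply: big_ind => // [|f g Jf Jg]; first exact: (ideal0 idJ).
have := idealB idJ Jf (idealB idJ (ideal0 idJ X Y) Jg).
by rewrite sub0r opprK.
Qed.

Definition ideal1 i j (f : phom K i j) : Prop := J (emb f).

(** Entries are obtained by composing with inclusions and projections; the
    converse is [matrix_units]. *)
Lemma idealP (X Y : obj t) (f : khom X Y) :
  J f <-> forall a b, ideal1 (entry (khom_val f) a b).
Proof.
split=> [Jf a b|Jf].
  by rewrite /ideal1 -emb_entry; apply/(ideal_postcomp idJ)/(ideal_precomp idJ).
have -> : f = \sum_(ab : carrier X * carrier Y)
    kcomp (kiota ab.2) (kcomp (emb (entry (khom_val f) ab.1 ab.2)) (kproj ab.1)).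
  apply: val_inj; rewrite /= khom_val_sum /=.
  rewrite -[LHS](eqP (khomP f)) {1}[khom_val f]matrix_units.
  rewrite (sum_sub (h := fun g => acomp t g (idem X)));
    last by move=> x y; apply: acompBl.
  rewrite (sum_sub (h := acomp t (idem Y))); last by move=> x y; apply: acompBr.
  apply: eq_bigr => -[a b] _ /=.
  by rewrite comp_single_id single_id_comp !acompA.
apply: ideal_sum => -[a b].
by apply/(ideal_postcomp idJ)/(ideal_precomp idJ); apply: Jf.
Qed.

Lemma ideal1_comp i j k (g : phom K j k) (f : phom K i j) :
  ideal1 g \/ ideal1 f -> ideal1 (pcomp t g f).
Proof.
have e : emb (pcomp t g f) = kcomp (emb g) (emb f).
  by apply: val_inj; rewrite /= acomp_single.
rewrite /ideal1 e; case=> H; first exact: (ideal_precomp idJ).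
exact: (ideal_postcomp idJ).
Qed.

Lemma ideal1_scale i j (a : K) (f : phom K i j) : ideal1 f -> ideal1 (a *: f).
Proof.
move=> Jf; have <- : pcomp t (a *: pid K j) f = a *: f.
  by rewrite /pcomp bilinZl -/(pcomp t _ _) pid_comp.
by apply: ideal1_comp; right.
Qed.

Lemma ideal1_0 i j : ideal1 (0 : phom K i j).
Proof.
rewrite /ideal1; have -> : emb (0 : phom K i j) = 0.
  by apply: khom_inj => a b; rewrite [RHS]entry0 /= entryE.
exact: (ideal0 idJ).
Qed.

Lemma ideal1_sum i j (I : finType) (F : I -> phom K i j) :
  (forall a, ideal1 (F a)) -> ideal1 (\sum_a F a).
Proof.
move=> JF; rewrite /ideal1; have -> : emb (\sum_a F a) = \sum_a emb (F a).
  apply: khom_inj => a b; rewrite khom_val_sum entry_sum /= entryE.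
  by apply: eq_bigr => c _; rewrite /= entryE.
exact: ideal_sum.
Qed.

(** The object [k (x) i] of the completion is only isomorphic to [k + i]: its
    index set is a product. So [id (x) f] is conjugated by the isomorphism. *)
Lemma ideal1_tens i j k (f : phom K i j) : ideal1 f -> ideal1 (ptens (pid K k) f).
Proof.
move=> /(ideal_tens idJ (obj1 k)) Jf; rewrite /ideal1.
pose pair m : ahom K (fam1 (k + m)) (fam_tens (fam1 k) (fam1 m)) :=
  @mkahom K (fam1 (k + m)) (fam_tens (fam1 k) (fam1 m)) (fun _ _ => pid K (k + m)).
pose unpair m : ahom K (fam_tens (fam1 k) (fam1 m)) (fam1 (k + m)) :=
  @mkahom K (fam_tens (fam1 k) (fam1 m)) (fam1 (k + m)) (fun _ _ => pid K (k + m)).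
have sum_uu (V : nmodType) (F : unit * unit -> V) : \sum_u F u = F (tt, tt).
  by rewrite (big_pred1 (tt, tt)) // => -[[] []].
have -> : emb (ptens (pid K k) f) =
    kcomp (@sandwich K t (obj_tens (obj1 k) (obj1 j)) (obj1 (k + j)) (unpair j))
      (kcomp (ktens (kid (obj1 k)) (emb f))
        (@sandwich K t (obj1 (k + i)) (obj_tens (obj1 k) (obj1 i)) (pair i))).
  apply: khom_inj => a b; rewrite /= -!acompA comp_single_id single_id_comp.
  rewrite !(acompA t (atens _ _)) !atens_comp !acomp_single !pid_comp.
  rewrite (acompA t (atens _ _)) atens_comp !acomp_single pid_comp pcomp_id.
  by rewrite !entryE sum_uu !entryE sum_uu !entryE /= pcomp_id pid_comp.
by apply/(ideal_postcomp idJ)/(ideal_precomp idJ).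
Qed.

End Ideal.
End OneObject.

(** * Matrices indexed by colourings, and negligible morphisms *)

Section Colouring.
Variables (K : fieldType) (n : nat).
Hypothesis n_gt0 : (0 < n)%N.
Let C := 'I_n.
Let t : K := n%:R.

(** The colour of a loop can be chosen in [n] ways, which is its weight. *)
Lemma value_comp i j k (g : phom K j k) (f : phom K i j) (x : 'I_i -> C) (z : 'I_k -> C) :
  value (pcomp t g f) (sumf x z) =
  \sum_(y : {ffun 'I_j -> C}) value f (sumf x y) * value g (sumf y z).
Proof.
rewrite /pcomp; elim/dvec_ind: f => [|a P f IHf].
  by rewrite bilin0r value0 big1 // => y _; rewrite value0 mul0r.
rewrite bilinPr valueP IHf.
under [RHS]eq_bigr do rewrite valueP mulrDl -mulrA.
rewrite big_split -big_distrr /=; congr (_ * _ + _) => {f IHf}.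
elim/dvec_ind: g => [|b Q g IHg].
  by rewrite bilin0l value0 big1 // => y _; rewrite value0 mulr0.
rewrite bilinPl valueP IHg.
under [RHS]eq_bigr do rewrite valueP mulrDr mulrCA.
rewrite big_split -big_distrr /=; congr (_ * _ + _) => {g IHg}.
rewrite bilin_dvec valueZ value_dvec mulrC /t -natrX -natrM.
rewrite -[X in (_ * X ^ _)%N](card_ord n) -(count_compat (Ordinal n_gt0)) natr_sum.
by apply: eq_bigr => y _; rewrite natrM !value_dvec.
Qed.

Lemma value_tens i j k l (f : phom K i j) (g : phom K k l)
    (x : 'I_(i + k) -> C) (y : 'I_(j + l) -> C) :
  value (ptens f g) (sumf x y) =
  value f (sumf (fun a => x (lshift k a)) (fun a => y (lshift l a))) *
  value g (sumf (fun a => x (rshift i a)) (fun a => y (rshift j a))).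
Proof.
rewrite /ptens; elim/dvec_ind: f => [|a P f IHf]; first by rewrite bilin0l !value0 mul0r.
rewrite bilinPl !valueP IHf mulrDl -mulrA; congr (_ * _ + _) => {f IHf}.
elim/dvec_ind: g => [|b Q g IHg]; first by rewrite bilin0r !value0 mulr0.
rewrite bilinPr !valueP IHg mulrDr mulrCA; congr (_ * _ + _) => {g IHg}.
by rewrite bilin_dvec valueZ mul1r !value_dvec compat_tens -natrM mulnb.
Qed.

Lemma value_flip (D : eqType) i j (f : phom K i j) (x : 'I_i -> D) (y : 'I_j -> D) :
  value (pflip f) (sumf y x) = value f (sumf x y).
Proof.
elim/dvec_ind: f => [|a P f IHf]; first by rewrite pflip0 !value0.
rewrite pflipP !valueP IHf; congr (_ * _ + _).
have -> : pflip (dvec K P) = dvec K (diag_flip P) by rewrite !dvec.unlock pflip_basis.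
by rewrite !value_dvec compat_flip.
Qed.

(** A basis of the image of [A] under the functor to vector spaces sending the
    generating object to the space with basis the set of colours. *)
Definition coloured (A : fam) : finType := {a : A & {ffun 'I_(deg a) -> C}}.

Definition colour_mx (A B : fam) (f : ahom K A B) (p : coloured A) (q : coloured B) : K :=
  value (entry f (tag p) (tag q)) (sumf (tagged p) (tagged q)).

Lemma colour_mx_comp (A B D : fam) (g : ahom K B D) (f : ahom K A B) p q :
  colour_mx (acomp t g f) p q = \sum_r colour_mx f p r * colour_mx g r q.
Proof.
rewrite /colour_mx entryE value_sum.
under eq_bigr do rewrite value_comp.
by rewrite sig_big_dep.
Qed.

Definition cpair (A B : fam) (p : coloured A) (q : coloured B) :
    coloured (fam_tens A B) :=
  @Tagged (fam_tens A B) (tag p, tag q) (fun ab => {ffun 'I_(deg ab) -> C})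
    [ffun k => match split k with inl a => tagged p a | inr b => tagged q b end].

Definition cfst (A B : fam) (p : coloured (fam_tens A B)) : coloured A :=
  Tagged (fun a : A => {ffun 'I_(deg a) -> C})
    [ffun k => tagged p (lshift (deg (tag p).2) k)].

Definition csnd (A B : fam) (p : coloured (fam_tens A B)) : coloured B :=
  Tagged (fun b : B => {ffun 'I_(deg b) -> C})
    [ffun k => tagged p (rshift (deg (tag p).1) k)].

Lemma cpairK (A B : fam) (p : coloured A) (q : coloured B) :
  (cfst (cpair p q), csnd (cpair p q)) = (p, q).
Proof.
case: p q => a x [b y]; rewrite /cfst /csnd /cpair /=.
by congr (_, _); congr existT; apply/ffunP=> k;
  rewrite !ffunE ?split_lshift ?split_rshift.
Qed.

Lemma cpair_eta (A B : fam) (p : coloured (fam_tens A B)) : cpair (cfst p) (csnd p) = p.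
Proof.
case: p => [[a b] x]; rewrite /cfst /csnd /cpair /=.
congr existT; apply/ffunP=> k; rewrite !ffunE.
by rewrite -[in RHS](splitK k); case: (split k) => m; rewrite /= ffunE.
Qed.

Lemma sum_cpair (A B : fam) (F : coloured (fam_tens A B) -> K) :
  \sum_p F p = \sum_p \sum_q F (cpair p q).
Proof.
rewrite pair_big (reindex (fun pq => cpair pq.1 pq.2)) //=.
exists (fun p => (cfst p, csnd p)) => [[p q] _|p _]; first exact: cpairK.
exact: cpair_eta.
Qed.

Lemma colour_mx_tens (A B A' B' : fam) (f : ahom K A B) (g : ahom K A' B') p q p' q' :
  colour_mx (atens f g) (cpair p p') (cpair q q') = colour_mx f p q * colour_mx g p' q'.
Proof.
case: p p' q q' => a x [a' x'] [b y] [b' y']; rewrite /colour_mx entryE value_tens.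
by congr (_ * _); apply: eq_value => -[] k; rewrite /= ffunE ?split_lshift ?split_rshift.
Qed.

Lemma colour_mx_dual (A B : fam) (f : ahom K A B) p q :
  colour_mx (adual f) q p = colour_mx f p q.
Proof. by rewrite /colour_mx entryE value_flip. Qed.

Lemma compat_ev (D : eqType) i (x : 'I_(i + i) -> D) (u : 'I_0 -> D) :
  compat (diag_ev i i) (sumf x u) = [forall k, x (lshift i k) == x (rshift i k)].
Proof.
apply/compatP/forallP => [H k|H v w].
  apply/eqP; apply: (H (inl (lshift i k)) (inl (rshift i k))).
  by rewrite same_fibers /dot_label split_lshift split_rshift.
case: v => [a|[]//]; case: w => [b|[]//]; rewrite same_fibers /dot_label /=.
rewrite -[in X in _ -> X](splitK a) -[in X in _ -> X](splitK b).
by case: (split a) (split b) => [k|k] [l|l] /eqP/val_inj-> //=; rewrite (eqP (H l)).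
Qed.

Lemma coloured_eq (A : fam) (a : A) (x y : {ffun 'I_(deg a) -> C}) :
  (Tagged (fun a : A => {ffun 'I_(deg a) -> C}) x == Tagged _ y) = (x == y).
Proof. exact: eq_Tagged. Qed.

Lemma coloured_neq (A : fam) (p q : coloured A) : tag p != tag q -> (p == q) = false.
Proof. by move=> /eqP npq; apply/eqP => epq; apply: npq; rewrite epq. Qed.

Lemma colour_mx_ev (A : fam) (p q : coloured A) u :
  colour_mx (aev K A) (cpair p q) u = (p == q)%:R.
Proof.
rewrite /colour_mx entryE /=; case: eqP => [|/eqP npq]; last first.
  by rewrite value0 coloured_neq.
case: p q => a x [b y] /= eab; case: b / eab in y *.
rewrite /pev -/(dvec _ _); have := value_dvec K (diag_ev (deg a) (deg a)).
rewrite dvec.unlock => ->; rewrite compat_ev coloured_eq; congr (nat_of_bool _)%:R.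
apply/forallP/eqP => [H|-> k]; last by rewrite !ffunE split_lshift split_rshift.
by apply/ffunP=> k; have := eqP (H k); rewrite !ffunE split_lshift split_rshift.
Qed.

Lemma colour_mx_co (A : fam) (p q : coloured A) u :
  colour_mx (aco K A) u (cpair p q) = (p == q)%:R.
Proof.
rewrite -(colour_mx_ev p q u) -[RHS]colour_mx_dual; congr colour_mx; apply: ahomP => a b.
rewrite !entryE; case: eqP => _; last by rewrite pflip0.
by rewrite /pev pflip_basis.
Qed.

Lemma compat_braid (D : eqType) i j (x : 'I_(i + j) -> D) (y : 'I_(j + i) -> D) :
  compat (diag_braid i j j i) (sumf x y) =
  [forall k, x (lshift j k) == y (rshift j k)]
  && [forall l, x (rshift i l) == y (lshift i l)].
Proof.
apply/compatP/andP => [H|[/forallP Hl /forallP Hr] v w].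
  split; apply/forallP=> k; apply/eqP.
    apply: (H (inl (lshift j k)) (inr (rshift j k))).
    by rewrite same_fibers /dot_label split_lshift split_rshift.
  apply: (H (inl (rshift i k)) (inr (lshift i k))).
  by rewrite same_fibers /dot_label split_lshift split_rshift.
pose z (m : 'I_i + 'I_j) :=
  match m with inl k => x (lshift j k) | inr l => x (rshift i l) end.
pose lab (v : 'I_(i + j) + 'I_(j + i)) : 'I_i + 'I_j :=
  match v with inl k => split k | inr k => sum_swap (split k) end.
have zE v' : sumf x y v' = z (lab v').
  case: v' => k /=; rewrite -[in LHS](splitK k); case: (split k) => l //=.
    by rewrite (eqP (Hr l)).
  by rewrite (eqP (Hl l)).
have labE v' w' : same (diag_braid i j j i) v' w' -> lab v' = lab w'.
  rewrite same_fibers /dot_label.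
  case: v' w' => a [] b /=;
    by case: (split a) (split b) => [k|k] [l|l] //= /eqP[] /val_inj->.
by move=> /labE vw; rewrite !zE vw.
Qed.

Lemma colour_mx_braid (A B : fam) (p p' : coloured A) (q q' : coloured B) :
  colour_mx (abraid K A B) (cpair p q) (cpair q' p') = ((p == p') && (q == q'))%:R.
Proof.
rewrite /colour_mx entryE /=; case: andP => [[/eqP ep /eqP eq]|npq]; last first.
  rewrite value0; case: andP => // -[/eqP ep /eqP eq]; case: npq.
  by rewrite ep eq !eqxx.
case: p p' ep => a x [a' x'] /= ea; case: a' / ea in x' *.
case: q q' eq => b y [b' y'] /= eb; case: b' / eb in y' *.
have := value_dvec K (diag_braid (deg a) (deg b) (deg b) (deg a)).
rewrite dvec.unlock => ->; rewrite compat_braid !coloured_eq.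
congr (nat_of_bool (_ && _))%:R.
  apply/forallP/eqP => [H|-> k]; last by rewrite !ffunE split_lshift split_rshift.
  by apply/ffunP=> k; have := eqP (H k); rewrite !ffunE split_lshift split_rshift.
apply/forallP/eqP => [H|-> k]; last by rewrite !ffunE split_lshift split_rshift.
by apply/ffunP=> k; have := eqP (H k); rewrite !ffunE split_lshift split_rshift.
Qed.

Definition no_dots : coloured fam_unit :=
  @Tagged unit tt (fun a => {ffun 'I_(@deg fam_unit a) -> C}) [ffun=> Ordinal n_gt0].

Lemma coloured_unitP (u v : coloured fam_unit) : u = v.
Proof. by case: u v => [[] x] [[] y]; congr existT; apply/ffunP=> -[]. Qed.

Lemma sum_coloured_unit (F : coloured fam_unit -> K) u : \sum_v F v = F u.
Proof. by rewrite (big_pred1 u) // => v; apply/esym/eqP/coloured_unitP. Qed.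

Lemma colour_mx_unit u v : colour_mx (aunit K) u v = 1.
Proof.
rewrite /colour_mx entryE; have := value_dvec K (diag_id 'I_0); rewrite dvec.unlock => ->.
by rewrite compat_id; case: forallP => // -[] [].
Qed.

Lemma sum_delta (T : finType) (F : T -> K) (p : T) : \sum_q (q == p)%:R * F q = F p.
Proof.
rewrite (bigD1 p) //= big1 ?addr0 ?eqxx ?mul1r // => q /negbTE->.
by rewrite mul0r.
Qed.

(** Neighbouring idempotents inserted by [sandwich] multiply to a single one,
    and [f] absorbs those next to it. *)
Lemma khom_val_trace (X : obj t) (f : khom X X) :
  khom_val (ktrace f) =
  acomp t (aunit K) (acomp t (aev K (carrier X))
    (acomp t (atens (idem X) (adual (idem X)))
      (acomp t (abraid K (carrier X) (carrier X))
        (acomp t (atens (adual (idem X)) (khom_val f))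
          (acomp t (aco K (carrier X)) (aunit K)))))).
Proof.
rewrite /= -!acompA; congr (acomp t _ (acomp t _ _)).
rewrite (acompA t (atens _ _) (atens _ _)) atens_comp idemP -adual_comp idemP.
congr (acomp t _ (acomp t _ _)).
rewrite (acompA t (atens _ _) (atens _ _)) atens_comp -adual_comp idemP hom_idl.
by rewrite (acompA t (atens _ _) (atens _ _)) atens_comp -adual_comp idemP hom_idr.
Qed.

Lemma colour_mx_trace (X : obj t) (f : khom X X) u v :
  colour_mx (khom_val (ktrace f)) u v = \sum_p colour_mx (khom_val f) p p.
Proof.
(* [s1] to [s4] are the matrices of longer and longer right factors of the
   composite; the idempotents are absorbed by [f]. *)
rewrite khom_val_trace colour_mx_comp (sum_coloured_unit _ v) colour_mx_unit mulr1.
rewrite colour_mx_comp sum_cpair; set e := idem X; set F := khom_val f.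
have s1 p q :
    colour_mx (acomp t (aco K (carrier X)) (aunit K)) u (cpair p q) = (p == q)%:R.
  by rewrite colour_mx_comp (sum_coloured_unit _ u) colour_mx_unit mul1r colour_mx_co.
have s2 p q : colour_mx (acomp t (atens (adual e) F)
    (acomp t (aco K (carrier X)) (aunit K))) u (cpair p q) = colour_mx F p q.
  rewrite colour_mx_comp sum_cpair -[F in RHS]hom_idr colour_mx_comp.
  apply: eq_bigr => r _; under eq_bigr do rewrite s1 colour_mx_tens colour_mx_dual eq_sym.
  by rewrite sum_delta.
set G2 := acomp t _ (acomp t (aco _ _) _) in s2 *.
have s3 p q : colour_mx (acomp t (abraid K _ _) G2) u (cpair q p) = colour_mx F p q.
  rewrite colour_mx_comp sum_cpair -(sum_delta (fun r => colour_mx F r q)).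
  apply: eq_bigr => r _; rewrite -(sum_delta (fun s => colour_mx F r s)) big_distrr /=.
  by apply: eq_bigr => s _; rewrite s2 colour_mx_braid -mulnb natrM mulrC mulrA.
set G3 := acomp t _ G2 in s3 *.
have s4 p q : colour_mx (acomp t (atens e (adual e)) G3) u (cpair q p) = colour_mx F p q.
  rewrite colour_mx_comp sum_cpair -[F in RHS](eqP (khomP f)) colour_mx_comp.
  apply: eq_bigr => r _; rewrite colour_mx_comp big_distrl; apply: eq_bigr => s _ /=.
  by rewrite s3 colour_mx_tens colour_mx_dual mulrA mulrC mulrA.
apply: eq_bigr => q _; rewrite -[RHS](sum_delta (fun p => colour_mx F p q)).
by apply: eq_bigr => p _; rewrite s4 colour_mx_ev mulrC eq_sym.
Qed.

Lemma colour_mx_inj_unit (f : ahom K fam_unit fam_unit) :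
  (forall u v, colour_mx f u v = 0) -> f = 0.
Proof.
move=> f0; apply: ahomP => -[] []; rewrite entry0; apply: value_eq0 => P.
rewrite -[RHS](f0 no_dots no_dots); apply: value_ker => -[[m lt_m0]|[m lt_m0]];
  by case: (elimF idP (ltn0 m) lt_m0).
Qed.

Lemma trace0P (X : obj t) (f : khom X X) :
  ktrace f = 0 <-> \sum_p colour_mx (khom_val f) p p = 0.
Proof.
split=> [f0|f0]; last first.
  by apply/val_inj/colour_mx_inj_unit => u v; rewrite -[RHS]f0; apply: colour_mx_trace.
by rewrite -(colour_mx_trace f no_dots no_dots) f0 /colour_mx [entry _ _ _]entry0 value0.
Qed.

Lemma colour_mx0_negligible (X Y : obj t) (f : khom X Y) :
  (forall p q, colour_mx (khom_val f) p q = 0) -> negligible f.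
Proof.
move=> f0 g; apply/trace0P; rewrite big1 // => p _.
by rewrite /= colour_mx_comp big1 // => q _; rewrite f0 mul0r.
Qed.

Lemma trace0_cyclic (X Y : obj t) (g : khom Y X) (f : khom X Y) :
  ktrace (kcomp g f) = 0 -> ktrace (kcomp f g) = 0.
Proof.
move=> /trace0P H; apply/trace0P; rewrite -[RHS]H /=.
under eq_bigr do rewrite colour_mx_comp; under [RHS]eq_bigr do rewrite colour_mx_comp.
rewrite exchange_big; apply: eq_bigr => p _; apply: eq_bigr => q _.
by rewrite mulrC.
Qed.

Hypothesis charK : [pchar K] =i pred0.

(** To see the entry of the matrix of [f] at the colourings [x] and [y], compose
    with the flipped indicator of the fibres of [(x, y)]. The trace counts each
    colouring with these fibres, so it is the entry times a positive integer. *)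
Lemma negligible_colour_mx0 (X Y : obj t) (f : khom X Y) :
  negligible f -> forall p q, colour_mx (khom_val f) p q = 0.
Proof.
move=> nf [a x] [b y]; rewrite /colour_mx /=; set F := entry _ _ _.
pose P := fibers (sumf x y); pose h := emb t (pflip (indicator K P)).
have := nf (kcomp (kiota a) (kcomp h (kproj b))).
have -> : kcomp (kcomp (kiota a) (kcomp h (kproj b))) f
    = kcomp (kiota a) (kcomp h (kcomp (kproj b) f)).
  by apply: val_inj; rewrite /= -!acompA.
move/trace0_cyclic.
have -> : kcomp (kcomp h (kcomp (kproj b) f)) (kiota a)
    = kcomp h (kcomp (kproj b) (kcomp f (kiota a))).
  by apply: val_inj; rewrite /= -!acompA.
rewrite emb_entry => /trace0P; rewrite -/F.
pose hits (p : coloured (fam1 (deg a))) (q : coloured (fam1 (deg b))) :=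
  fibers (sumf (tagged p) (tagged q)) == P.
have -> : \sum_p colour_mx (khom_val (kcomp h (emb t F))) p p
   = value F (sumf x y) * (\sum_p \sum_q hits p q)%:R.
  rewrite natr_sum big_distrr; apply: eq_bigr => p _.
  rewrite [LHS]colour_mx_comp natr_sum big_distrr; apply: eq_bigr => q _ /=.
  rewrite /colour_mx !entryE value_flip value_indicator -/(hits p q).
  case: (boolP (hits p q)) => [/eqP/esym pq|_]; last by rewrite !mulr0.
  congr (_ * _); apply: value_ker => u v.
  by rewrite -!same_fibers -/P pq.
move/eqP; rewrite mulf_eq0 => /orP[/eqP //|].
pose px : coloured (fam1 (deg a)) :=
  @Tagged unit tt (fun=> {ffun 'I_(deg a) -> C}) x.
pose qy : coloured (fam1 (deg b)) :=
  @Tagged unit tt (fun=> {ffun 'I_(deg b) -> C}) y.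
rewrite ((pcharf0P K).1 charK) sum_nat_eq0 => /forallP/(_ px) /=.
by rewrite sum_nat_eq0 => /forallP/(_ qy); rewrite /hits eqxx.
Qed.

Lemma negligibleP (X Y : obj t) (f : khom X Y) :
  negligible f <-> forall p q, colour_mx (khom_val f) p q = 0.
Proof. by split; [exact: negligible_colour_mx0|exact: colour_mx0_negligible]. Qed.

Lemma colour_mxB (A B : fam) (f g : ahom K A B) p q :
  colour_mx (f - g) p q = colour_mx f p q - colour_mx g p q.
Proof. by rewrite /colour_mx entryD entryN valueD valueN. Qed.

Lemma negligible_ideal : tensor_ideal (@negligible K t).
Proof.
split=> [X Y|X Y f g|X Y Z f g|X Y Z f g|X Y Z f].
- by apply/negligibleP => p q; rewrite /colour_mx [entry _ _ _]entry0 value0.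
- move=> /negligibleP f0 /negligibleP g0; apply/negligibleP => p q.
  by rewrite [LHS]colour_mxB f0 g0 subrr.
- move=> /negligibleP f0; apply/negligibleP => p q /=.
  by rewrite colour_mx_comp big1 // => r _; rewrite f0 mul0r.
- move=> /negligibleP g0; apply/negligibleP => p q /=.
  by rewrite colour_mx_comp big1 // => r _; rewrite g0 mulr0.
- move=> /negligibleP f0; apply/negligibleP => p q /=.
  by rewrite -(cpair_eta p) -(cpair_eta q) colour_mx_tens f0 mulr0.
Qed.

Lemma negligible_not_zero : ~ same_family (@negligible K t) (@zero_ideal K t).
Proof.
pose f := emb t (inj_indicator K n.+1).
move=> H; have /(H _ _ f) : negligible f.
  apply/negligibleP => p q; rewrite /colour_mx entryE value_inj_indicator.
  case: injectiveP => // inj_c; suff: (#|'I_n.+1| <= #|'I_n|)%N.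
    by rewrite !card_ord ltnn.
  apply: (leq_card (tagged q)) => a b ab.
  by apply: inr_inj; apply: inj_c.
rewrite /zero_ideal => /(congr1
  (fun f : khom (obj1 t 0) (obj1 t n.+1) => entry (khom_val f) tt tt)).
rewrite [LHS]entryE [RHS]entry0 => /(congr1 (fun f => value f id)).
rewrite value_inj_indicator value0; case: injectiveP => [_ /eqP|[] //].
by rewrite oner_eq0.
Qed.

Lemma negligible_not_whole : ~ same_family (@negligible K t) (@whole_category K t).
Proof.
move=> H; have /negligibleP f0 := (H _ _ (kid (obj_unit t))).2 I.
by have /eqP := f0 no_dots no_dots; rewrite [colour_mx _ _ _]colour_mx_unit oner_eq0.
Qed.

End Colouring.

(** * Levels of a tensor ideal *)

Definition nblocks (T : finType) (P : setpart T) : nat := #|val P|.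

Lemma number_blocks (T : finType) (P : setpart T) :
  exists (num : T -> 'I_(nblocks P)) (rep : 'I_(nblocks P) -> T),
    cancel rep num /\ forall u v, (num u == num v) = same P u v.
Proof.
have /and3P[/eqP coverP trivP P0] := valP P.
have blockP u : block P u \in val P by rewrite pblock_mem // coverP inE.
pose num u := enum_rank_in (blockP u) (block P u).
have numK u : enum_val (num u) = block P u by apply: enum_rankK_in.
have numE u v : (num u == num v) = same P u v.
  by rewrite -eq_block -!numK (inj_eq enum_val_inj).
have rep_exists k : exists u, num u = k.
  have [B0|[u uB]] := set_0Vmem (enum_val k).
    by rewrite -B0 enum_valP in P0.
  exists u; apply: enum_val_inj; rewrite numK; apply: def_pblock uB => //.
  exact: enum_valP.
by have [rep repK] := fin_all_exists rep_exists; exists num, rep.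
Qed.

Section Classification.
Variables (K : fieldType) (n : nat).
Let t : K := n%:R.
Hypothesis charK : [pchar K] =i pred0.

Section Ideal.
Variables (J : hom_family t) (idJ : tensor_ideal J).

Lemma ideal1_transport i j i' j' (p : 'I_i + 'I_j -> 'I_i' + 'I_j')
    (h : phom K i' j') (f : phom K i j) :
  ideal1 J f -> ideal1 J (transport t p h f).
Proof.
move=> Jf; rewrite transport.unlock dvec.unlock.
by apply: ideal1_comp => //; right; apply: ideal1_comp => //; left; apply: ideal1_tens.
Qed.

Lemma ideal1_unscale i j (a : K) (f : phom K i j) :
  a != 0 -> ideal1 J (a *: f) -> ideal1 J f.
Proof.
by move=> a0 /(ideal1_scale idJ a^-1); rewrite scalerA mulVf // scale1r.
Qed.

Definition level (r : nat) : Prop := ideal1 J (inj_indicator K r).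

(** Numbering the blocks of [P] gives a map of dots along which [f] pulls back,
    on injective colourings, to its value at [P]. *)
Lemma level_of i j (f : phom K i j) P :
  ideal1 J f -> value f (block P) != 0 -> level (nblocks P).
Proof.
move=> Jf fP; have [num [_ [_ numE]]] := number_blocks P.
pose p (u : 'I_i + 'I_j) : 'I_0 + 'I_(nblocks P) := inr (num u).
apply: (ideal1_unscale fP).
have <- : transport t p (inj_indicator K _) f = value f (block P) *: inj_indicator K _.
  apply: value_inj => R; rewrite value_transport valueZ !value_inj_indicator.
  case: injectiveP => [inj_R|_]; last by rewrite !mulr0.
  congr (_ * _); apply: value_ker => u v.
  rewrite (inj_eq inj_R) eq_block -numE; exact: inj_eq inr_inj _ _.
exact: ideal1_transport.
Qed.

(** Choosing a dot in each block gives a map of dots along which the indicator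
    of injective colourings pulls back to a function with value 1 at [P]. *)
Lemma ideal1_of_levels i j (f : phom K i j) :
  (forall P, value f (block P) != 0 -> level (nblocks P)) -> ideal1 J f.
Proof.
move=> lev; have -> : f = \sum_P value f (block P) *: indicator K P.
  apply: value_inj => R; rewrite value_sum (bigD1 R) //= big1 ?addr0 => [|P nP].
    by rewrite valueZ value_indicator fibers_block eqxx mulr1.
  by rewrite valueZ value_indicator fibers_block eq_sym (negbTE nP) mulr0.
apply: (ideal1_sum idJ) => P.
have [->|fP] := eqVneq (value f (block P)) 0.
  by rewrite scale0r; apply: ideal1_0.
apply: ideal1_scale => //; have [num [rep [repK numE]]] := number_blocks P.
pose p (u : 'I_0 + 'I_(nblocks P)) : 'I_i + 'I_j :=
  match u with
  | inl a => False_rect _ (elimF idP (ltn0 a) (ltn_ord a))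
  | inr b => rep b
  end.
have -> : indicator K P = transport t p (indicator K P) (inj_indicator K _).
  apply: value_inj => R; rewrite value_transport value_inj_indicator value_indicator.
  rewrite fibers_block; have [->|_] := eqVneq R P; last by rewrite mulr0.
  case: injectiveP => [_|[]]; first by rewrite mul1r.
  move=> [[]//|a] [[]//|b] /eqP; rewrite /= eq_block -numE !repK => /eqP->.
  by [].
exact/ideal1_transport/lev.
Qed.

Lemma levelS r : level r -> level r.+1.
Proof. by rewrite /level (inj_indicatorS r t); apply: ideal1_transport. Qed.

Lemma level_up r s : (r <= s)%N -> level r -> level s.
Proof.
move=> /subnK <-; elim: (s - r)%N => // m IH /IH; exact: levelS.
Qed.

(** The scalar of [cap_inj_indicator] is invertible. *)
Lemma level_pred r : r != n -> level r.+1 -> level r.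
Proof.
move=> nrn lev; apply: (@ideal1_unscale _ _ (t - r%:R)); last first.
  by rewrite -cap_inj_indicator; apply: ideal1_comp => //; right.
have nat0 m : (m%:R == 0 :> K) = (m == 0)%N by apply: (pcharf0P K).1.
rewrite /t; have [lt_rn|lt_nr|ern] := ltngtP r n; last by rewrite ern eqxx in nrn.
  by rewrite -natrB 1?ltnW // nat0 subn_eq0 -ltnNge.
by rewrite -opprB oppr_eq0 -natrB 1?ltnW // nat0 subn_eq0 -ltnNge.
Qed.

Lemma level_down r s : (r <= s)%N -> (forall m, (r <= m < s)%N -> m != n) ->
  level s -> level r.
Proof.
elim: s => [|s IH]; first by rewrite leqn0 => /eqP->.
rewrite leq_eqVlt => /orP[/eqP-> //|]; rewrite ltnS => le_rs avoid lev.
apply: IH => // [m /andP[rm ms]|]; first by rewrite avoid // rm ltnW.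
by apply: level_pred => //; apply: avoid; rewrite le_rs leqnn.
Qed.

Lemma level_gt r : ~ same_family J (@whole_category K t) -> level r -> (n < r)%N.
Proof.
move=> proper lev; rewrite ltnNge; apply/negP => le_rn; apply: proper => X Y f.
split=> // _; apply/(idealP idJ) => a b; apply: ideal1_of_levels => P _.
apply: (level_up (leq0n _)); apply: level_down lev => // m /andP[_ lt_mr].
by rewrite neq_ltn (leq_trans lt_mr le_rn).
Qed.

(** A level [s > n] yields [n.+1] going down, since [n] itself is not reached,
    and then all larger ones; a level at most [n] would yield 0 and then
    everything. That a nonzero ideal has a level at all is classical, its
    membership being undecided. *)
Lemma levelP r : nontrivial_tensor_ideal J -> level r <-> (n < r)%N.
Proof.
move=> [_ nonzero proper]; split=> [|lt_nr]; first exact: level_gt.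
apply: NNPP => nlev; apply: nonzero => X Y f; split=> [|->]; last exact: (ideal0 idJ).
move/(idealP idJ) => Jf; apply: khom_inj => a b; rewrite [RHS]entry0.
apply: value_eq0 => P; apply/eqP; apply/negPn/negP => fP.
have lev := level_of (Jf a b) fP; apply: nlev.
apply: (level_up lt_nr); apply: (level_down _ _ lev); first exact: level_gt lev.
by move=> m /andP[lt_nm _]; rewrite neq_ltn lt_nm orbT.
Qed.

Lemma nontrivial_idealP (X Y : obj t) (f : khom X Y) : nontrivial_tensor_ideal J ->
  J f <-> forall a b P,
    value (entry (khom_val f) a b) (block P) != 0 -> (n < nblocks P)%N.
Proof.
move=> ntJ; split=> [/(idealP idJ) Jf a b P fP|H].
  by apply/(levelP _ ntJ); apply: level_of fP.
apply/(idealP idJ) => a b; apply: ideal1_of_levels => P fP.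
exact/(levelP _ ntJ)/(H a b).
Qed.

End Ideal.
End Classification.

Local Close Scope ring_scope.

Theorem proposition3p4p1 (K : closedFieldType) (charK : [pchar K]%R =i pred0)
    (t : nat) (t_gt0 : 0 < t) :
  nontrivial_tensor_ideal (@negligible K (t%:R)%R) /\
  forall J : hom_family (K := K) (t%:R)%R,
    nontrivial_tensor_ideal J -> same_family J (@negligible K (t%:R)%R).
Proof.
have ntN : nontrivial_tensor_ideal (@negligible K (t%:R)%R).
  split; [exact: negligible_ideal|exact: negligible_not_zero|exact: negligible_not_whole].
split=> // J ntJ X Y f; have [idJ _ _] := ntJ; have [idN _ _] := ntN.
by rewrite (nontrivial_idealP charK idJ f ntJ) (nontrivial_idealP charK idN f ntN).
Qed.
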